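(* Let $n\geq 2$ be an integer, let $\Lambda\geq\lambda>0$ and let $p\in\mathbb{R}$ satisfy $$-1\leq p\leq \frac{\frac{\Lambda}{\lambda}\, n+1}{\frac{\Lambda}{\lambda}\, n-1}.$$ Then there does not exist any positive viscosity solution $u$ of the inequality $$\mathcal{M}^-_{\lambda,\Lambda}(D^2u)+u^p\leq 0\qquad\text{in } \mathbb{R}^n_+ .$$
   Context: $\mathbb{R}^n_+=\{x=(x',x_n)\in\mathbb{R}^{n-1}\times\mathbb{R} : x_n>0\}$. For a real symmetric $n\times n$ matrix $M$ with eigenvalues $\mu_1,\dots,\mu_n$, the Pucci inf-operator is $$\mathcal{M}^-_{\lambda,\Lambda}(M)=\lambda\sum_{\mu_i>0}\mu_i+\Lambda\sum_{\mu_i<0}\mu_i=\inf_{A}\operatorname{tr}(AM),$$ the infimum being over symmetric matrices $A$ with all eigenvalues in $[\lambda,\Lambda]$. A positive viscosity solution of the inequality is a lower semicontinuous function $u:\mathbb{R}^n_+\to(0,+\infty)$ such that, whenever $x_0\in\mathbb{R}^n_+$ and $\varphi$ is a $C^2$ function near $x_0$ such that $u-\varphi$ has a local minimum at $x_0$, one has $\mathcal{M}^-_{\lambda,\Lambda}(D^2\varphi(x_0))+u(x_0)^p\leq 0$. *)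

(* Defs.v *)
From mathcomp Require Export all_boot all_order all_algebra.
From mathcomp Require Export all_classical all_reals all_analysis.
Export Order.TTheory GRing.Theory Num.Theory.
Export numFieldNormedType.Exports.

Set Implicit Arguments.
Unset Strict Implicit.
Unset Printing Implicit Defensive.

Local Open Scope classical_set_scope.
Local Open Scope ring_scope.

(* The index [i] with [i.+1 = n] is the last one, so that [x 0 i] is the
   coordinate written x_n with 1-based indices. *)
Definition halfspace (R : realType) (n : nat) : set 'rV[R]_n :=
  [set x | forall i : 'I_n, i.+1 = n -> 0 < x 0 i].

Section C2.
Context {R : realType} {n : nat}.
Implicit Types (phi : 'rV[R]_n -> R) (x : 'rV[R]_n).

Definition partial (i : 'I_n) phi : 'rV[R]_n -> R := 'D_('e_i) phi.

Definition hessian phi x : 'M[R]_n :=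
  \matrix_(i, j) partial j (partial i phi) x.

Definition C1_near phi x : Prop :=
  \forall y \near x, {for y, continuous phi} /\
    forall i : 'I_n, derivable phi y 'e_i /\ {for y, continuous (partial i phi)}.

Definition C2_near phi x : Prop :=
  C1_near phi x /\ forall i : 'I_n, C1_near (partial i phi) x.

End C2.

(* Each eigenvalue is counted with its multiplicity as a root of the
   characteristic polynomial; the index sets of the sums are finite. *)
Definition pucci_inf (R : realType) (n : nat) (lambda Lambda : R)
    (M : 'M[R]_n) : R :=
  lambda * (\sum_(a \in [set a | eigenvalue M a /\ (0 < a)%R])
              a *+ mup a (char_poly M)) +
  Lambda * (\sum_(a \in [set a | eigenvalue M a /\ (a < 0)%R])
              a *+ mup a (char_poly M)).

(* Functions on the half-space are represented by total functions; the values
   outside the half-space are never constrained: the half-space is open, and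
   in the topology of [subspace D] the points outside [D] are isolated. *)
Definition positive_viscosity_solution (R : realType) (n : nat)
    (lambda Lambda p : R) (u : 'rV[R]_n -> R) : Prop :=
  [/\ forall x, halfspace x -> 0 < u x,
      lower_semicontinuous
        (fun x : subspace (@halfspace R n) => (u x)%:E) &
      forall (x0 : 'rV[R]_n) (phi : 'rV[R]_n -> R),
        halfspace x0 -> C2_near phi x0 ->
        (\forall x \near x0, u x0 - phi x0 <= u x - phi x) ->
        pucci_inf lambda Lambda (hessian phi x0) + u x0 `^ p <= 0].

(* Main.v *)
(* Let [a = Lambda / lambda].  At a point where a smooth [phi] touches a solution
   [u] from below, [M^-(D^2 phi) + u^p <= 0], so every [phi] with
   [M^-(D^2 phi) + u^p > 0] wherever [phi > u], and which lies below [u] on the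
   boundary of a compact box, lies below [u] inside the box.
   - For [-1 <= p <= 0], [eta^-1 (x_N - 1) (|x|^(-2 eta^2) - S^(-eta^2))], up to a
     small constant, is such a function, and it is unbounded as [eta -> 0].
   - A paraboloid over a ball of radius [rho] gives [m^p <= C m / rho^2], where [m]
     is the minimum of [u] in a smaller ball; a radial barrier gives [m <= C rho].
     Together they exclude [0 < p <= 1].
   - [Phi = x_N^a |x|^(1 - (n+1) a)] satisfies [M^-(D^2 Phi) >= 0], hence
     [u >= c Phi].  For [p > 1], up to the critical exponent, [u^p >= (c Phi)^p]
     leaves room to improve this to [u >= eps/delta Phi (1 - |x|^(-2 delta))]
     uniformly in [delta], a substitute for [Phi log |x|].  This contradicts
     [m^(p-1) <= C / rho^2] as [rho -> oo] and then [delta -> 0]. *)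

Require Import Defs.
From mathcomp Require Import spectral sesquilinear complex ring lra.

Set Implicit Arguments.
Unset Strict Implicit.
Unset Printing Implicit Defensive.

Local Open Scope classical_set_scope.
Local Open Scope ring_scope.

(** * The Pucci operator as a trace *)

(** The operator is replaced, at each touching point, by the trace against one optimal matrix; all
    test functions depend on x_N and |x - c|^2 only, so every barrier check ends as a real
    inequality in four entries of that matrix. Nothing is known of [u] as x_N tends to 0, so
    comparisons are made in x_N >= 1, which keeps the boxes compact inside the half-space; there
    positivity is the only boundary information on the plane x_N = 1. With [nu = n a - 1], the
    function Phi has degree [- nu], and the upper bound on [p] says exactly [nu * (p - 1) <= 2]: at
    infinity, away from the boundary, Phi^p is then at least of order Phi / |x|^2, the size of the
    operator on a logarithmic correction of Phi. The obstacle is the boundary. With [t] the height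
    and [r] the radius, the correction also creates a mixed term of size Phi / (t r), which Phi^p
    does not control as [t] tends to 0. A corrector of size Phi t / r, with the same homogeneity,
    has a positive second derivative in [t] of just this size and absorbs it. *)

Lemma char_poly_conj (K : fieldType) (n : nat) (P A : 'M[K]_n) :
  P \in unitmx -> char_poly (invmx P *m A *m P) = char_poly A.
Proof.
move=> Pu; rewrite /char_poly.
have -> : char_poly_mx (invmx P *m A *m P) =
    map_mx polyC (invmx P) *m char_poly_mx A *m map_mx polyC P.
  rewrite /char_poly_mx mulmxBr mulmxBl !map_mxM /= scalar_mxC.
  by rewrite -(mulmxA 'X%:M) -(map_mxM _ (invmx P) P) mulVmx // map_mx1 mulmx1.
rewrite !det_mulmx mulrAC -det_mulmx -map_mxM mulVmx //.
by rewrite map_mx1 det1 mul1r.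
Qed.

Lemma conj_complexE (R : rcfType) (z : R[i]%C) : Num.conj z = conjc z.
Proof.
have [->|z0] := eqVneq z 0; first by rewrite rmorph0 conjc0.
by apply: (mulfI z0); rewrite -normCK sqr_normc.
Qed.

(* [p i] and [q i] are the real and imaginary parts of an orthonormal basis of
   eigenvectors of the complexified matrix. *)
Lemma symmetric_spectral (R : rcfType) (n : nat) (M : 'M[R]_n) :
  (forall k l, M k l = M l k) ->
  exists (d : 'I_n -> R) (p q : 'I_n -> 'I_n -> R),
  [/\ char_poly M = \prod_i ('X - (d i)%:P),
      forall k l, \sum_i (p i k * p i l + q i k * q i l) = (k == l)%:R,
      forall i, \sum_k (p i k ^+ 2 + q i k ^+ 2) = 1 &
      forall i, \sum_k \sum_l (p i k * p i l + q i k * q i l) * M k l = d i].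
Proof.
move=> symM; pose rc : {rmorphism R -> R[i]%C} := real_complex R.
pose Mc := map_mx rc M.
have Mreal : Mc \is a mxOver Num.real.
  by apply/mxOverP => k l; rewrite mxE; apply/complex_realP; exists (M k l).
have Msym : Mc \is symmetricmx.
  apply/is_hermitianmxP; rewrite expr0 scale1r; apply/matrixP => k l.
  by rewrite !mxE symM.
have Mnorm := symmetric_normalmx Msym Mreal.
have /mxOverP dreal := hermitian_spectral_diag_real (realsym_hermsym Msym Mreal).
have /orthomx_spectralP := Mnorm.
set P := spectralmx Mc; set sp := spectral_diag Mc => ME.
have Punit : P \is unitarymx := spectral_unitarymx Mc.
have Pu : P \in unitmx := spectral_unit Mc.
pose d i := Re (sp 0 i).
have spE i : sp 0 i = rc (d i).
  by rewrite /d; have /complex_realP[k ->] := dreal 0 i.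
exists d, (fun i k => Re (P i k)), (fun i k => Im (P i k)).
have reE (z w : R[i]%C) : Re (z * Num.conj w) = Re z * Re w + Im z * Im w.
  by rewrite conj_complexE; case: z w => [a b] [a' b'] /=; rewrite mulrN opprK.
(* Orthonormal rows of a square matrix give orthonormal columns; the real part of this identity is
   the resolution of the identity below. *)
have PP : P^T *m map_mx Num.conj P = 1%:M.
  rewrite -[LHS]trmxK trmx_mul trmxK map_trmx (mulmx1C _) ?trmx1 //.
  by apply/unitarymxP.
split.
- apply: (map_poly_inj rc); rewrite map_char_poly -/Mc ME char_poly_conj //.
  rewrite char_poly_trig ?diag_mx_is_trig // rmorph_prod; apply: eq_bigr => i _.
  by rewrite mxE eqxx mulr1n spE /= rmorphB /= map_polyX map_polyC.
- move=> k l; have /matrixP/(_ k l) := PP.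
  rewrite !mxE => /(congr1 (@Re R)).
  rewrite raddf_sum /= => E.
  transitivity (Re ((k == l)%:R : R[i]%C)); last by case: (k == l).
  by rewrite -E; apply: eq_bigr => i _; rewrite !mxE reE.
- move=> i; have /unitarymxP/matrixP/(_ i i) := Punit.
  rewrite !mxE eqxx => /(congr1 (@Re R)).
  rewrite raddf_sum /= => <-.
  by apply: eq_bigr => k _; rewrite !mxE reE !expr2.
- move=> i; have : P *m Mc *m (map_mx Num.conj P^T) = diag_mx sp.
    rewrite ME !mulmxA mulmxV // mul1mx -mulmxA.
    by have /unitarymxP -> := Punit; rewrite mulmx1.
  move=> /matrixP/(_ i i); rewrite !mxE eqxx mulr1n spE.
  move=> /(congr1 (@Re R)) /= <-; rewrite raddf_sum /= exchange_big.
  apply: eq_bigr => l _; rewrite !mxE mulr_suml raddf_sum /=.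
  apply: eq_bigr => k _; rewrite !mxE mulrAC.
  by rewrite -reE; case: (P i k * _) => a b /=; rewrite mulr0 subr0.
Qed.


Lemma fsbig_eigenvalues (R : realType) (n : nat) (M : 'M[R]_n)
    (d : 'I_n -> R) (P : pred R) :
  char_poly M = \prod_i ('X - (d i)%:P) ->
  \sum_(a \in [set a | eigenvalue M a /\ P a]%classic) a *+ mup a (char_poly M) =
  \sum_(i | P (d i)) d i.
Proof.
move=> Md; pose ds := [seq d i | i <- enum 'I_n].
have Mds : char_poly M = \prod_(y <- ds) ('X - y%:P) by rewrite Md big_map big_enum.
have eigE a : eigenvalue M a = (a \in ds).
  by rewrite eigenvalue_root_char Mds root_prod_XsubC.
rewrite (fsbigE [seq a <- undup ds | P a]); first last.
- by move=> a /= [aM Pa]; rewrite mem_filter mem_undup Pa -eigE aM.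
- by move=> a /=; rewrite mem_filter mem_undup -eigE => /andP[].
- by rewrite filter_uniq ?undup_uniq.
rewrite big_filter_cond big_seq_cond (eq_bigl (fun a => (a \in undup ds) && P a)).
  rewrite -big_seq_cond.
  (* The multiplicity of a root is its number of occurrences in [ds], so the weighted sum over
     distinct roots is the plain sum over the list. *)
  rewrite (eq_bigr (fun a => iterop (count_mem a ds) +%R a 0)).
    by rewrite big_undup_iterop_count big_map big_enum_cond.
  by move=> a _; rewrite Mds mu_prod_XsubC.
move=> a; rewrite mem_undup -eigE.
apply/idP/idP => [/and3P[-> ->]//|/andP[aM Pa]].
by rewrite aM Pa /= inE.
Qed.

(* The last property says that the trace dominates every diagonal entry of the
   positive semidefinite matrix [Lambda - A]. *)
Lemma pucci_inf_attained (R : realType) (n : nat) (lambda Lambda : R) (M : 'M[R]_n) :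
  lambda <= Lambda -> (forall k l, M k l = M l k) ->
  exists A : 'M[R]_n,
  [/\ forall k l, A k l = A l k,
      forall x : 'I_n -> R,
        lambda * \sum_k x k ^+ 2 <= \sum_k \sum_l A k l * x k * x l
          <= Lambda * \sum_k x k ^+ 2,
      pucci_inf lambda Lambda M = \sum_k \sum_l A k l * M k l &
      forall x : 'I_n -> R,
        Lambda * (\sum_k x k ^+ 2) - \sum_k \sum_l A k l * x k * x l <=
        (Lambda * n%:R - \sum_k A k k) * \sum_k x k ^+ 2].
Proof.
move=> leL symM.
have [d [p [q [Md pq1 pq2 dE]]]] := symmetric_spectral symM.
(* The optimal matrix is diagonal in the eigenbasis of [M], with the cheaper weight for each sign; a
   zero eigenvalue contributes nothing, so its weight is free. *)
pose a i := if 0 < d i then lambda else Lambda.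
have aL i : lambda <= a i <= Lambda by rewrite /a; case: ifP; rewrite lexx leL.
pose A : 'M[R]_n := \matrix_(k, l) \sum_i a i * (p i k * p i l + q i k * q i l).
have qE (c : 'I_n -> R) (x : 'I_n -> R) :
    \sum_k \sum_l (\sum_i c i * (p i k * p i l + q i k * q i l)) * x k * x l =
    \sum_i c i * ((\sum_k p i k * x k) ^+ 2 + (\sum_k q i k * x k) ^+ 2).
  under eq_bigr => k _ do under eq_bigr => l _ do rewrite !mulr_suml.
  under eq_bigr => k _ do rewrite exchange_big /=.
  rewrite exchange_big /=; apply: eq_bigr => i _.
  rewrite !expr2 !big_distrlr /= -big_split /= mulr_sumr; apply: eq_bigr => k _.
  rewrite -big_split mulr_sumr; apply: eq_bigr => l _ /=; ring.
have AE (x : 'I_n -> R) : \sum_k \sum_l A k l * x k * x l =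
    \sum_i a i * ((\sum_k p i k * x k) ^+ 2 + (\sum_k q i k * x k) ^+ 2).
  by rewrite -qE; apply: eq_bigr => k _; apply: eq_bigr => l _; rewrite mxE.
have xE (x : 'I_n -> R) : \sum_k x k ^+ 2 =
    \sum_i ((\sum_k p i k * x k) ^+ 2 + (\sum_k q i k * x k) ^+ 2).
  have pq1' k l : \sum_i 1 * (p i k * p i l + q i k * q i l) = (k == l)%:R.
    by rewrite -mulr_sumr mul1r pq1.
  rewrite -[RHS](eq_bigr _ (fun i _ => mul1r _)) -(qE (fun=> 1)).
  apply: eq_bigr => k _; rewrite (bigD1 k) //= pq1' eqxx mul1r -expr2.
  by rewrite big1 ?addr0 // => l lk; rewrite pq1' eq_sym (negbTE lk) !mul0r.
have trE : \sum_k A k k = \sum_i a i.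
  under eq_bigr do rewrite mxE.
  rewrite exchange_big /=; apply: eq_bigr => i _.
  rewrite -mulr_sumr (eq_bigr (fun k => p i k ^+ 2 + q i k ^+ 2)) ?pq2 ?mulr1 //.
exists A; split.
- by move=> k l; rewrite !mxE; apply: eq_bigr => i _; congr (_ * _); ring.
- move=> x; rewrite AE xE !mulr_sumr; apply/andP; split; apply: ler_sum => i _;
    by rewrite ler_wpM2r ?addr_ge0 ?sqr_ge0 //; have /andP[] := aL i.
- rewrite /pucci_inf !(@fsbig_eigenvalues _ _ _ d (fun a => 0 < a)) //.
  rewrite (@fsbig_eigenvalues _ _ _ d (fun a => a < 0)) //.
  transitivity (\sum_i a i * d i).
    rewrite !mulr_sumr big_mkcond [X in _ + X]big_mkcond -big_split /=.
    apply: eq_bigr => i _; rewrite /a.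
    by case: ltgtP => [||<-]; rewrite ?addr0 ?add0r ?mulr0.
  under [RHS]eq_bigr => k _ do under eq_bigr => l _ do rewrite mxE mulr_suml.
  under [RHS]eq_bigr => k _ do rewrite exchange_big /=.
  rewrite exchange_big /=; apply: eq_bigr => i _.
  rewrite -(dE i) mulr_sumr; apply: eq_bigr => k _.
  by rewrite mulr_sumr; apply: eq_bigr => l _; rewrite mulrA.
- move=> x; rewrite AE trE xE mulr_sumr -sumrB.
  have -> : Lambda * n%:R - \sum_i a i = \sum_i (Lambda - a i).
    by rewrite sumrB sumr_const card_ord mulr_natr.
  rewrite mulr_suml; apply: ler_sum => i _.
  rewrite -mulrBl ler_wpM2l ?subr_ge0 //; first by have /andP[] := aL i.
  rewrite [leRHS](bigD1 i) //= lerDl sumr_ge0 // => j _.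
  by rewrite addr_ge0 ?sqr_ge0.
Qed.

(** * Hessians of functions of x_N and |x - c|^2 *)

Section C2_data.
Context {R : realType} {n : nat}.
Implicit Types (U : set 'rV[R]_n) (phi psi : 'rV[R]_n -> R) (x : 'rV[R]_n).
Implicit Types (G : 'I_n -> 'rV[R]_n -> R) (H : 'I_n -> 'I_n -> 'rV[R]_n -> R).

(** Restriction to a line makes the one-variable chain rule available for directional
    derivatives. *)
Lemma is_derive_line (phi : 'rV[R]_n -> R) (x v : 'rV[R]_n) (b : R) :
  is_derive x v phi b <-> is_derive (0 : R) 1 (fun h : R => phi (h *: v + x)) b.
Proof.
have E : (fun h : R => h^-1 *: ((phi \o shift x) (h *: v) - phi x)) =
    (fun h : R => h^-1 *: (((fun h : R => phi (h *: v + x)) \o shift 0) (h *: 1) -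
       phi (0 *: v + x))).
  by apply/funext => h /=; rewrite addr0 scale0r add0r [_%:A]mulr1.
by split=> -[dphi <-]; split; move: dphi; rewrite /derivable /derive E.
Qed.

Lemma is_derive_comp_dir (f : R -> R) phi (x v : 'rV[R]_n) (a b : R) :
  is_derive (phi x) 1 f a -> is_derive x v phi b ->
  is_derive x v (fun y => f (phi y)) (a * b).
Proof.
move=> df /is_derive_line dphi; apply/is_derive_line.
have df' : is_derive (phi (0 *: v + x)) 1 f a by rewrite scale0r add0r.
exact: (is_derive1_comp (g := fun h : R => phi (h *: v + x))).
Qed.

(** [G] and [H] are explicit candidates for the gradient and the hessian. Carrying them through
    sums, products and compositions yields closed formulas instead of iterated limits. *)
Definition C2_data U phi G H := open U /\ forall x, U x ->
  [/\ {for x, continuous phi}, forall i, is_derive x 'e_i phi (G i x),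
      forall i, {for x, continuous (G i)},
      forall i j, is_derive x 'e_j (G i) (H i j x) &
      forall i j, {for x, continuous (H i j)}].

(** Since [U] is open, [partial i phi] and [G i] agree in a whole neighbourhood of each point of
    [U], so they share derivatives and continuity there. *)
Lemma C2_data_near U phi G H x : C2_data U phi G H -> U x ->
  C2_near phi x /\ forall i j, hessian phi x i j = H i j x.
Proof.
move=> [oU data] Ux.
have partialE i y : U y -> partial i phi y = G i y.
  by move=> /data[_ d _ _ _]; have [_ <-] := d i.
have near_partial i y : U y -> \near y, G i y = partial i phi y.
  move=> Uy; near=> z; rewrite partialE //; near: z.
  exact: open_nbhs_nbhs.
have dpartial i j y : U y -> is_derive y 'e_j (partial i phi) (H i j y).
  move=> Uy; apply: (near_eq_is_derive (near_partial i y Uy)).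
  by have [_ _ _ + _] := data _ Uy; apply.
have ppE i j y : U y -> partial j (partial i phi) y = H i j y.
  by move=> Uy; have [_ <-] := dpartial i j y Uy.
have cts (f g : 'rV[R]_n -> R) y : U y -> (forall z, U z -> g z = f z) ->
    {for y, continuous g} -> {for y, continuous f}.
  move=> Uy fg cg; rewrite /prop_for /continuous_at -(fg y Uy).
  have fgy : \near y, g y = f y.
    by near=> z; rewrite fg //; near: z; exact: open_nbhs_nbhs.
  by apply: cvg_trans cg; exact: near_eq_cvg fgy.
split; [split|].
- near=> y; have Uy : U y by near: y; exact: open_nbhs_nbhs.
  have [cphi dphi cG _ _] := data _ Uy.
  split=> // i; split; first by have [] := dphi i.
  by apply: (cts _ (G i)) => // z Uz; rewrite partialE.
- move=> i; near=> y; have Uy : U y by near: y; exact: open_nbhs_nbhs.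
  have [cphi dphi cG _ cH] := data _ Uy.
  split; first by apply: (cts _ (G i)) => // z Uz; rewrite partialE.
  move=> j; split; first by have [] := dpartial i j _ Uy.
  by apply: (cts _ (H i j)) => // z Uz; rewrite ppE.
- by move=> i j; rewrite mxE ppE.
Unshelve. all: by end_near.
Qed.

Lemma C2_data_cst U (c : R) : open U ->
  C2_data U (fun=> c) (fun _ _ => 0) (fun _ _ _ => 0).
Proof.
by move=> oU; split=> // x _; split=> *; (exact: cst_continuous || exact: is_derive_cst).
Qed.

Lemma is_derive_coord (x v : 'rV[R]_n) (k : 'I_n) :
  is_derive x v (fun y => y 0 k) (v 0 k).
Proof.
apply/is_derive_line.
have -> : (fun h : R => (h *: v + x) 0 k) = id * cst (v 0 k) + cst (x 0 k).
  by apply/funext => h; rewrite !mxE.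
apply: is_derive_eq.
by rewrite /= scaler0 add0r addr0 [_%:A]mulr1.
Qed.

Lemma C2_data_coord U (k : 'I_n) : open U ->
  C2_data U (fun x => x 0 k) (fun i _ => (k == i)%:R) (fun _ _ _ => 0).
Proof.
move=> oU; split=> // x _; split=> *; try exact: cst_continuous.
- exact: coord_continuous.
- by apply: is_derive_eq; [exact: is_derive_coord|rewrite mxE eqxx].
- exact: is_derive_cst.
Qed.

Lemma C2_dataD U phi G H psi G' H' :
  C2_data U phi G H -> C2_data U psi G' H' ->
  C2_data U (fun x => phi x + psi x) (fun i x => G i x + G' i x)
    (fun i j x => H i j x + H' i j x).
Proof.
move=> [oU d] [_ d']; split=> // x Ux.
have [c1 c2 c3 c4 c5] := d x Ux; have [c1' c2' c3' c4' c5'] := d' x Ux.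
by split=> *; (exact: is_deriveD || exact: continuousD).
Qed.

Lemma C2_dataM U phi G H psi G' H' :
  C2_data U phi G H -> C2_data U psi G' H' ->
  C2_data U (fun x => phi x * psi x)
    (fun i x => phi x * G' i x + psi x * G i x)
    (fun i j x => phi x * H' i j x + G' i x * G j x +
                  (psi x * H i j x + G i x * G' j x)).
Proof.
move=> [oU d] [_ d']; split=> // x Ux.
have [c1 c2 c3 c4 c5] := d x Ux; have [c1' c2' c3' c4' c5'] := d' x Ux.
split=> *.
- exact: continuousM.
- exact: is_deriveM.
- by apply: continuousD; apply: continuousM.
- by apply: is_deriveD; apply: is_deriveM.
- by apply: continuousD; apply: continuousD; apply: continuousM.
Qed.

Lemma C2_data_comp U (f f' f'' : R -> R) phi G H :
  C2_data U phi G H ->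
  (forall x, U x -> [/\ is_derive (phi x) 1 f (f' (phi x)),
     is_derive (phi x) 1 f' (f'' (phi x)) & {for phi x, continuous f''}]) ->
  C2_data U (fun x => f (phi x)) (fun i x => f' (phi x) * G i x)
    (fun i j x => f' (phi x) * H i j x + G i x * (f'' (phi x) * G j x)).
Proof.
move=> [oU d] df; split=> // x Ux.
have [c1 c2 c3 c4 c5] := d x Ux; have [df1 df2 cf] := df x Ux.
have cts (h : R -> R) : {for phi x, continuous h} ->
    {for x, continuous (fun y => h (phi y))}.
  by move=> ch; apply: continuous_comp.
have dcts (h : R -> R) a : is_derive (phi x) 1 h a -> {for phi x, continuous h}.
  by move=> [dh _]; apply: differentiable_continuous; apply/derivable1_diffP.
split=> *.
- exact: cts (dcts _ _ df1).
- exact: is_derive_comp_dir.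
- by apply: continuousM => //; exact: cts (dcts _ _ df2).
- by apply: is_deriveM => //; exact: is_derive_comp_dir.
- apply: continuousD; apply: continuousM => //.
  + exact: cts (dcts _ _ df2).
  + by apply: continuousM => //; exact: cts.
Qed.

Lemma C2_data_sqdist U (c : 'rV[R]_n) : open U ->
  C2_data U (fun x => \sum_k (x 0 k - c 0 k) ^+ 2)
    (fun i x => 2 * (x 0 i - c 0 i)) (fun i j _ => 2 * (i == j)%:R).
Proof.
move=> oU.
have coord i := C2_data_coord i oU.
have ctsq i x : {for x, continuous (fun y : 'rV[R]_n => y 0 i - c 0 i)}.
  by apply: continuousB; [exact: coord_continuous|exact: cst_continuous].
have dsq i x v : is_derive x v (fun y : 'rV[R]_n => y 0 i - c 0 i) (v 0 i).
  apply: is_derive_eq; first exact: is_deriveB (is_derive_coord x v i) (is_derive_cst _ _ _).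
  by rewrite subr0.
split=> // x _; split=> [|i|i|i j|i j]; last exact: cst_continuous.
- apply: (continuous_big add_continuous) => k _ y.
  exact: (continuous_comp (ctsq k y) (@exprn_continuous _ 2 _)).
- have := is_derive_sum (fun k => is_deriveX 2 (dsq k x 'e_i)).
  have -> : \sum_k ((fun y : 'rV[R]_n => y 0 k - c 0 k) ^+ 2) =
      (fun y : 'rV[R]_n => \sum_k (y 0 k - c 0 k) ^+ 2).
    by apply/funext => y; rewrite fct_sumE.
  move=> /is_derive_eq; apply.
  rewrite (bigD1 i) //= big1 => [|k ki]; last first.
    by rewrite mxE (negbTE ki) andbF scaler0.
  by rewrite mxE !eqxx addr0 [_%:A]mulr1 expr1.
- by apply: continuousM => //; exact: cst_continuous.
- have := is_deriveM (is_derive_cst (2 : R) x 'e_j) (dsq i x 'e_j).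
  by move=> /is_derive_eq; apply; rewrite scaler0 addr0 mxE eqxx.
Qed.

End C2_data.

Definition sqdist (R : realType) (n : nat) (c x : 'rV[R]_n) : R :=
  \sum_k (x 0 k - c 0 k) ^+ 2.

Section ts_hess.
Context {R : realType} {n : nat} (N : 'I_n) (c : 'rV[R]_n).
Implicit Types (U : set 'rV[R]_n) (phi psi : 'rV[R]_n -> R).

(* For [phi x = F(x_N, |x - c|^2)] the hessian has this shape, where the four
   coefficients are [F_tt], [F_ts], [F_ss] and [F_s]. *)
Definition ts_hess U phi (ctt cts css cs : 'rV[R]_n -> R) :=
  exists G H, C2_data U phi G H /\ forall x, U x -> forall i j,
    let y k := x 0 k - c 0 k in
    H i j x = ctt x * ((N == i)%:R * (N == j)%:R) +
      2 * cts x * ((N == i)%:R * y j + y i * (N == j)%:R) +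
      4 * css x * (y i * y j) + 2 * cs x * (i == j)%:R.

(** Every test function below is a sum of such products and constants. *)
Lemma ts_hess_mul U (f f' f'' g g' g'' : R -> R) : open U ->
  (forall x, U x ->
    [/\ is_derive (x 0 N) 1 f (f' (x 0 N)),
        is_derive (x 0 N) 1 f' (f'' (x 0 N)) & {for x 0 N, continuous f''}]) ->
  (forall x, U x ->
    [/\ is_derive (sqdist c x) 1 g (g' (sqdist c x)),
        is_derive (sqdist c x) 1 g' (g'' (sqdist c x)) &
        {for sqdist c x, continuous g''}]) ->
  ts_hess U (fun x => f (x 0 N) * g (sqdist c x))
    (fun x => f'' (x 0 N) * g (sqdist c x))
    (fun x => f' (x 0 N) * g' (sqdist c x))
    (fun x => f (x 0 N) * g'' (sqdist c x))
    (fun x => f (x 0 N) * g' (sqdist c x)).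
Proof.
move=> oU df dg.
have := C2_dataM (C2_data_comp (C2_data_coord N oU) df)
  (C2_data_comp (C2_data_sqdist c oU) dg).
set G := (X in C2_data _ _ X _); set H := (X in C2_data _ _ _ X) => data.
exists G, H; split=> // x Ux i j; rewrite /H /= /sqdist.
by ring.
Qed.

Lemma ts_hessD U phi psi ctt cts css cs ctt' cts' css' cs' :
  ts_hess U phi ctt cts css cs -> ts_hess U psi ctt' cts' css' cs' ->
  ts_hess U (fun x => phi x + psi x) (fun x => ctt x + ctt' x)
    (fun x => cts x + cts' x) (fun x => css x + css' x) (fun x => cs x + cs' x).
Proof.
move=> [G [H [data HE]]] [G' [H' [data' HE']]].
eexists _, _; split; first exact: C2_dataD data data'.
by move=> x Ux i j /=; rewrite HE // HE' //=; ring.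
Qed.

Lemma ts_hess_cst U (k : R) : open U ->
  ts_hess U (fun=> k) (fun=> 0) (fun=> 0) (fun=> 0) (fun=> 0).
Proof.
move=> oU; eexists _, _; split; first exact: C2_data_cst.
by move=> x Ux i j /=; ring.
Qed.

End ts_hess.

Section C2_at.
Context {R : realType}.
Implicit Types (f g : R -> R).

Definition C2_at (f f' f'' : R -> R) (y : R) :=
  [/\ is_derive y 1 f (f' y), is_derive y 1 f' (f'' y) & {for y, continuous f''}].

Lemma C2_at_cst (k y : R) : C2_at (fun=> k) (fun=> 0) (fun=> 0) y.
Proof. by split; (exact: cst_continuous || exact: is_derive_cst). Qed.

Lemma C2_at_id (y : R) : C2_at id (fun=> 1) (fun=> 0) y.
Proof.
by split; (exact: cst_continuous || exact: is_derive_cst || exact: is_derive_id).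
Qed.

Lemma C2_atD f f' f'' g g' g'' y : C2_at f f' f'' y -> C2_at g g' g'' y ->
  C2_at (fun y => f y + g y) (fun y => f' y + g' y) (fun y => f'' y + g'' y) y.
Proof.
move=> [d1 d2 c] [d1' d2' c']; split; try exact: is_deriveD.
exact: continuousD.
Qed.

Lemma C2_atZ (k : R) f f' f'' y : C2_at f f' f'' y ->
  C2_at (fun y => k * f y) (fun y => k * f' y) (fun y => k * f'' y) y.
Proof.
move=> [d1 d2 c]; split; try exact: is_deriveZ.
by apply: continuousM => //; exact: cst_continuous.
Qed.

Lemma C2_at_powR (a y : R) : 0 < y ->
  C2_at (fun y => y `^ a) (fun y => a * y `^ (a - 1))
    (fun y => a * ((a - 1) * y `^ (a - 1 - 1))) y.
Proof.
move=> y0; have d b := is_derive1_powR b y0.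
split; first exact: d.
  exact: is_deriveZ (d (a - 1)).
have [/derivable1_diffP/differentiable_continuous dp _] := d (a - 1 - 1).
by apply: continuousM; [exact: cst_continuous|apply: continuousM => //; exact: cst_continuous].
Qed.

Lemma C2_at_shift (k : R) f f' f'' y : C2_at f f' f'' (y - k) ->
  C2_at (fun y => f (y - k)) (fun y => f' (y - k)) (fun y => f'' (y - k)) y.
Proof.
move=> [d1 d2 c].
have ds : is_derive y 1 (fun y : R => y - k) 1.
  have := is_deriveB (is_derive_id y (1 : R)) (is_derive_cst k y 1).
  by move=> /is_derive_eq; apply; rewrite subr0.
have comp (h : R -> R) b : is_derive (y - k) 1 h b ->
    is_derive y 1 (fun y => h (y - k)) b.
  move=> dh; have := is_derive1_comp (g := fun y : R => y - k) dh ds.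
  by move=> /is_derive_eq; apply; rewrite mulr1.
split; [exact: comp|exact: comp|].
apply: continuous_comp => //.
by apply: continuousB => //; exact: cst_continuous.
Qed.

End C2_at.

(** * Touching a solution from below *)

(* The values [A_NN], [(A y)_N], [(A y) . y] and [tr A] for a symmetric [A]
   with spectrum in [lambda, Lambda]; here [s = |y|^2] and [t = y_N]. *)
Definition elliptic (R : realType) (n : nat) (lambda Lambda t s a00 a0y ayy tr : R) :=
  [/\ forall al be : R,
        lambda * (al ^+ 2 + 2 * al * be * t + be ^+ 2 * s)
          <= al ^+ 2 * a00 + 2 * al * be * a0y + be ^+ 2 * ayy
          <= Lambda * (al ^+ 2 + 2 * al * be * t + be ^+ 2 * s),
      lambda * n%:R <= tr <= Lambda * n%:R &
      Lambda * s - ayy <= (Lambda * n%:R - tr) * s].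

Section touch.
Context {R : realType} {n : nat} (N : 'I_n).
Hypothesis Nlast : N.+1 = n.
Implicit Types (U K : set 'rV[R]_n) (phi psi : 'rV[R]_n -> R).

Lemma halfspaceE (x : 'rV[R]_n) : halfspace x <-> 0 < x 0 N.
Proof.
split=> [|xN i iN]; first exact.
by have -> : i = N by apply: val_inj; apply: succn_inj; rewrite iN Nlast.
Qed.

(** The hessian singles out only the directions [e_N] and [x - c], apart from a multiple of the
    identity. Hence the quadratic form of the optimal matrix matters only on their span, together
    with its trace. *)
Lemma ts_hess_elliptic (c : 'rV[R]_n) U phi ctt cts css cs (lambda Lambda : R) x :
  lambda <= Lambda -> ts_hess N c U phi ctt cts css cs -> U x ->
  C2_near phi x /\ exists a00 a0y ayy tr,
    elliptic n lambda Lambda (x 0 N - c 0 N) (sqdist c x) a00 a0y ayy tr /\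
    pucci_inf lambda Lambda (hessian phi x) =
      ctt x * a00 + 4 * cts x * a0y + 4 * css x * ayy + 2 * cs x * tr.
Proof.
move=> leL [G [H [data HE]]] Ux.
have [C2phi hessE] := C2_data_near data Ux; split=> //.
pose y k := x 0 k - c 0 k.
pose e k : R := (N == k)%:R.
have hessE' i j : hessian phi x i j =
  ctt x * (e i * e j) + 2 * cts x * (e i * y j + y i * e j) +
      4 * css x * (y i * y j) + 2 * cs x * (i == j)%:R by rewrite hessE HE.
have [|A [symA ellA pucA trA]] := @pucci_inf_attained _ _ lambda Lambda (hessian phi x) leL.
  by move=> k l; rewrite !hessE' (eq_sym k l); ring.
have sum_e (F : 'I_n -> R) : \sum_k e k * F k = F N.
  rewrite (bigD1 N) //= /e eqxx mul1r big1 ?addr0 // => k kN.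
  by rewrite eq_sym (negbTE kN) mul0r.
have sum_e' (F : 'I_n -> R) : \sum_k F k * e k = F N.
  by rewrite -[RHS]sum_e; apply: eq_bigr => k _; rewrite mulrC.
have sum_d (F : 'I_n -> R) i : \sum_j F j * (i == j)%:R = F i.
  rewrite (bigD1 i) //= eqxx mulr1 big1 ?addr0 // => k kN.
  by rewrite eq_sym (negbTE kN) mulr0.
pose Q (v w : 'I_n -> R) := \sum_k \sum_l A k l * v k * w l.
have Qee : Q e e = A N N.
  rewrite /Q; under eq_bigr do rewrite sum_e'.
  by rewrite sum_e'.
have Qsym v w : Q v w = Q w v.
  rewrite /Q exchange_big; apply: eq_bigr => k _; apply: eq_bigr => l _.
  by rewrite symA mulrAC.
pose a0y := Q e y.
have Qlin (al be : R) : Q (fun k => al * e k + be * y k) (fun k => al * e k + be * y k) =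
    al ^+ 2 * A N N + 2 * al * be * a0y + be ^+ 2 * Q y y.
  have -> : 2 * al * be * a0y = al * be * Q e y + al * be * Q y e.
    by rewrite (Qsym y e) /a0y; ring.
  rewrite -Qee /Q !mulr_sumr -!big_split /=; apply: eq_bigr => k _.
  rewrite !mulr_sumr -!big_split /=; apply: eq_bigr => l _; ring.
have normlin (al be : R) : \sum_k (al * e k + be * y k) ^+ 2 =
    al ^+ 2 + 2 * al * be * (x 0 N - c 0 N) + be ^+ 2 * sqdist c x.
  have -> : al ^+ 2 = al ^+ 2 * \sum_k e k * e k by rewrite sum_e /e eqxx mulr1.
  have -> : x 0 N - c 0 N = \sum_k e k * y k by rewrite sum_e.
  rewrite /sqdist !mulr_sumr -!big_split /=; apply: eq_bigr => k _.
  by rewrite /y; ring.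
exists (A N N), a0y, (Q y y), (\sum_k A k k); split.
  split.
  - by move=> al be; rewrite -normlin -Qlin; apply: ellA.
  - have Akk k : lambda <= A k k <= Lambda.
      have sum_k (F : 'I_n -> R) : \sum_j F j * (k == j)%:R = F k := sum_d F k.
      have := ellA (fun j => (k == j)%:R).
      under eq_bigr do rewrite expr2; rewrite sum_k eqxx !mulr1.
      by under eq_bigr do rewrite sum_k; rewrite sum_k.
    have nE (a : R) : a * n%:R = \sum_(k < n) a.
      by rewrite sumr_const card_ord mulr_natr.
    by rewrite !nE; apply/andP; split; apply: ler_sum => k _; have /andP[] := Akk k.
  - by have := trA y.
rewrite pucA.
have -> : 4 * cts x * a0y = 2 * cts x * Q e y + 2 * cts x * Q y e.
  by rewrite (Qsym y e) /a0y; ring.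
have -> : \sum_k A k k = \sum_k \sum_l A k l * (k == l)%:R.
  by apply: eq_bigr => k _; rewrite sum_d.
rewrite -Qee /Q !mulr_sumr -!big_split /=; apply: eq_bigr => k _.
rewrite !mulr_sumr -!big_split /=; apply: eq_bigr => l _; rewrite hessE'; ring.
Qed.

Lemma sqdist_continuous (c : 'rV[R]_n) : continuous (sqdist c).
Proof.
by move=> x; have [_ /(_ x I)[]] := C2_data_sqdist c (@openT 'rV[R]_n).
Qed.

Lemma open_ts (c : 'rV[R]_n) (tau sig : R) :
  open [set x : 'rV[R]_n | tau < x 0 N /\ sig < sqdist c x].
Proof.
apply: openI.
  apply: (@open_comp _ _ (fun x : 'rV[R]_n => x 0 N) [set y | tau < y]).
    by move=> x _; exact: coord_continuous.
  exact: open_gt.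
apply: (@open_comp _ _ (sqdist c) [set y | sig < y]).
  by move=> x _; exact: sqdist_continuous.
exact: open_gt.
Qed.

(** Taking [s1 = -1] imposes nothing, because [sqdist] is nonnegative; the same box thus serves for
    balls and for annuli. *)
Definition tsbox (c : 'rV[R]_n) (t0 s1 s2 : R) : set 'rV[R]_n :=
  [set x : 'rV[R]_n | [/\ t0 <= x 0 N, s1 <= sqdist c x & sqdist c x <= s2]].

Lemma compact_tsbox c t0 s1 s2 : compact (tsbox c t0 s1 s2).
Proof.
(* A radius without square root: [z <= z ^+ 2 + 1]. *)
pose r := s2 + 1.
apply: (@subclosed_compact _ _
  [set v : 'rV[R]_n | forall i, `[c 0 i - r, c 0 i + r]%classic (v 0 i)]).
- have -> : tsbox c t0 s1 s2 = (fun x : 'rV[R]_n => x 0 N) @^-1` [set y | t0 <= y] `&`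
     (sqdist c @^-1` [set y | s1 <= y] `&` sqdist c @^-1` [set y | y <= s2]).
    by apply/seteqP; split=> x [] // ? [].
  apply: closedI; last apply: closedI.
  + apply: preimage_closed; last exact: closed_ge.
    by move=> x _; exact: coord_continuous.
  + apply: preimage_closed; last exact: closed_ge.
    by move=> x _; exact: sqdist_continuous.
  + apply: preimage_closed; last exact: closed_le.
    by move=> x _; exact: sqdist_continuous.
- apply: (@rV_compact _ _ (fun i => `[c 0 i - r, c 0 i + r]%classic)) => i.
  exact: segment_compact.
- move=> x [_ _ xs2] i /=; rewrite in_itv /= -ler_distlC.
  have xi : (x 0 i - c 0 i) ^+ 2 <= s2.
    apply: le_trans xs2; rewrite /sqdist (bigD1 i) //= lerDl.
    by apply: sumr_ge0 => k _; exact: sqr_ge0.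
  rewrite distrC; have := sqr_ge0 (`|x 0 i - c 0 i| - 1).
  have := real_normK (num_real (x 0 i - c 0 i)); rewrite /r.
  set z := `|_|; have : 0 <= z by exact: normr_ge0.
  by move: xi; nra.
Qed.

Lemma lsc_min_compact (u : 'rV[R]_n -> R) (K : set 'rV[R]_n) :
  compact K -> K !=set0 ->
  (forall x (a : R), K x -> a < u x -> \forall y \near x, a < u y) ->
  exists2 x0, K x0 & forall x, K x -> u x0 <= u x.
Proof.
move=> /compact_near_coveringP cK [y0 Ky0] lsc; apply: contrapT => nomin.
have below x : K x -> exists2 z, K z & u z < u x.
  move=> Kx; apply: contrapT => nz; apply: nomin; exists x => // z Kz.
  by rewrite leNgt; apply/negP => zx; apply: nz; exists z.
(* Compactness is applied to the filter of the sublevel sets of [u] in [K]. *)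
pose F : set_system 'rV[R]_n := fun Q => exists2 y, K y &
  forall z, K z -> u z <= u y -> Q z.
have FF : Filter F.
  split.
  - by exists y0.
  - move=> P Q [y Ky yP] [z Kz zQ].
    have [yz|/ltW zy] := leP (u y) (u z).
      by exists y => // w Kw wy; split; [exact: yP|apply: zQ => //; exact: le_trans yz].
    by exists z => // w Kw wz; split; [apply: yP => //; exact: le_trans zy|exact: zQ].
  - by move=> P Q PQ [y Ky yP]; exists y => // z Kz zy; apply/PQ/yP.
have [|y Ky yP] := cK _ F (fun y x => u y < u x) FF.
  move=> x Kx; have [z Kz zx] := below x Kx.
  exists ([set x' | u z < u x'], [set y | u y <= u z]) => /=.
    by split; [exact: lsc|exists z].
  by move=> [x' y] /= [zx' yz]; exact: le_lt_trans zx'.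
by have := yP y Ky (lexx _) y Ky; rewrite /= ltxx.
Qed.

Lemma open_halfspace : open (@halfspace R n).
Proof.
have -> : @halfspace R n = [set x : 'rV[R]_n | 0 < x 0 N /\ -1 < sqdist 0 x].
  apply/seteqP; split=> x.
    move=> /halfspaceE xN; split=> //; apply: (@lt_le_trans _ _ 0); first lra.
    by apply: sumr_ge0 => k _; exact: sqr_ge0.
  by move=> [xN _]; apply/halfspaceE.
exact: open_ts.
Qed.

(** The half-space is open, so at its points the subspace topology has the ambient
    neighbourhoods. *)
Lemma solution_lsc (lambda Lambda p : R) (u : 'rV[R]_n -> R) x a :
  positive_viscosity_solution lambda Lambda p u ->
  halfspace x -> a < u x -> \forall y \near x, a < u y.
Proof.
move=> [_ u_lsc _] Hx ax; have [|V xV Va] := u_lsc x a; first by rewrite lte_fin.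
have : nbhs (x : subspace (@halfspace R n)) V by [].
rewrite -nbhs_subspace_interior; last by have /interior_id -> := open_halfspace.
by apply: filterS => y /Va; rewrite lte_fin.
Qed.

Lemma solution_min (lambda Lambda p : R) (u : 'rV[R]_n -> R) (c : 'rV[R]_n) t0 s1 s2 :
  positive_viscosity_solution lambda Lambda p u -> 0 < t0 ->
  tsbox c t0 s1 s2 !=set0 ->
  exists2 x0, tsbox c t0 s1 s2 x0 & forall x, tsbox c t0 s1 s2 x -> u x0 <= u x.
Proof.
move=> sol t0_gt0 ne; apply: lsc_min_compact => // [|x a [t0x _ _]].
  exact: compact_tsbox.
by apply: (solution_lsc sol); apply/halfspaceE; exact: lt_le_trans t0x.
Qed.

(** The minimum of [u - phi] over the box is negative because of [xb]. As [phi > u] happens only in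
    the open part of the box, this minimum is a local one in the whole space and [phi] is an
    admissible test function there. *)
Lemma viscosity_touch (lambda Lambda p : R) (u : 'rV[R]_n -> R)
    (c : 'rV[R]_n) (t0 s1 s2 : R) U phi ctt cts css cs xb :
  lambda <= Lambda -> positive_viscosity_solution lambda Lambda p u ->
  ts_hess N c U phi ctt cts css cs -> 0 < t0 ->
  (forall x, tsbox c t0 s1 s2 x -> U x) ->
  (forall x, tsbox c t0 s1 s2 x -> u x < phi x ->
    [/\ t0 < x 0 N, s1 < sqdist c x & sqdist c x < s2]) ->
  tsbox c t0 s1 s2 xb -> u xb < phi xb ->
  exists x a00 a0y ayy tr, [/\ tsbox c t0 s1 s2 x, u x < phi x,
    elliptic n lambda Lambda (x 0 N - c 0 N) (sqdist c x) a00 a0y ayy tr &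
    ctt x * a00 + 4 * cts x * a0y + 4 * css x * ayy + 2 * cs x * tr + u x `^ p <= 0].
Proof.
move=> leL sol; have [u_gt0 u_lsc u_visc] := sol; move=> hess t0_gt0 KU Kint Kxb uxb.
have KH x : tsbox c t0 s1 s2 x -> halfspace x.
  by move=> [t0x _ _]; apply/halfspaceE; exact: lt_le_trans t0x.
have phi_cts x : U x -> {for x, continuous phi}.
  by have [G [H [[_ data] _]]] := hess => /data[].
have [|x0 Kx0 x0min] := @lsc_min_compact (fun x => u x - phi x) _
    (@compact_tsbox c t0 s1 s2) (ex_intro _ xb Kxb).
  move=> x a Kx; set d := u x - phi x => ad.
  have e_gt0 : 0 < (d - a) / 2 by lra.
  have unear : \forall y \near x, u x - (d - a) / 2 < u y.
    by apply: (solution_lsc sol); [exact: KH|lra].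
  have pnear : \forall y \near x, `|phi x - phi y| < (d - a) / 2.
    by have /cvgrPdist_lt := phi_cts x (KU x Kx); apply.
  apply: filterS2 unear pnear => y uy; rewrite ltr_norml => /andP[py1 py2].
  by move: uy py1 py2 e_gt0; rewrite /d; lra.
have ux0 : u x0 < phi x0 by have := x0min xb Kxb; lra.
have [C2phi [a00 [a0y [ayy [tr [ell pucE]]]]]] :=
  ts_hess_elliptic leL hess (KU x0 Kx0).
exists x0, a00, a0y, ayy, tr; split=> //.
rewrite -pucE; apply: u_visc => //; first exact: KH.
have [x01 x02 x03] := Kint x0 Kx0 ux0.
have n1 : \forall x \near x0, t0 < (x : 'rV[R]_n) 0 N /\ s1 < sqdist c x.
  by apply: open_nbhs_nbhs; split; [exact: open_ts|].
have n2 : \forall x \near x0, sqdist c x < s2.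
  apply: open_nbhs_nbhs; split => //.
  apply: (@open_comp _ _ (sqdist c) [set y | y < s2]); last exact: open_lt.
  by move=> x _; exact: sqdist_continuous.
apply: filterS2 n1 n2 => x [h1 h2] h3; apply: x0min.
by split; exact: ltW.
Qed.

End touch.

(** * Real inequalities behind the barriers *)

Lemma powR_div (R : realType) (x y r : R) : 0 <= x -> 0 < y ->
  (x / y) `^ r = x `^ r * y `^ (- r).
Proof.
move=> x_ge0 y_gt0; rewrite powRM ?invr_ge0 ?(ltW y_gt0) //.
by rewrite -(powR_inv1 (ltW y_gt0)) -powRrM mulN1r.
Qed.

Lemma powR_subr1 (R : realType) (x r : R) : 0 < x -> x `^ (r - 1) = x `^ r * x^-1.
Proof.
move=> x0; rewrite powRD ?(gt_eqF x0) ?implybT //.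
by rewrite (powR_inv1 (ltW x0)).
Qed.

Lemma powR_le1 (R : realType) (t : R) : 0 < t -> t ^+ 2 <= 1 -> forall r, 0 <= r -> t `^ r <= 1.
Proof.
move=> t0 t1 r r0; have t01 : 0 < t <= 1 by rewrite t0; nra.
by rewrite -[leRHS](powRr0 t); exact: ger_powR.
Qed.

(** The mixed entry is bounded as in Cauchy-Schwarz: the form is nonnegative on [r e_N + y] and on
    [r e_N - y], and its diagonal values are at most [Lambda * r ^+ 2]. *)
Lemma elliptic_bounds (R : realType) (n : nat) (lambda Lambda t r a00 a0y ayy tr : R) :
  0 < lambda -> 0 < r -> - r <= t <= r ->
  elliptic n lambda Lambda t (r ^+ 2) a00 a0y ayy tr ->
  [/\ lambda <= a00 <= Lambda, lambda * r ^+ 2 <= ayy <= Lambda * r ^+ 2,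
      - (Lambda * r) <= a0y <= Lambda * r & lambda * n%:R <= tr <= Lambda * n%:R].
Proof.
move=> l0 r0 /andP[tr1 tr2] [ell1 ell2 _].
have := ell1 1 0; rewrite !expr0n !expr1n /= !mulr0 !mul0r !addr0 !mul1r !mulr1 => b00.
have := ell1 0 1; rewrite !expr0n !expr1n /= !mulr0 !mul0r !add0r !mul1r => byy.
split=> //; move: (b00) (byy) => /andP[b1 b2] /andP[b3 b4]; apply/andP; split.
- have /andP[h _] := ell1 r 1.
  have : 0 <= lambda * (r ^+ 2 + 2 * r * 1 * t + 1 ^+ 2 * r ^+ 2).
    by rewrite mulr_ge0 ?(ltW l0) //; nra.
  have : r ^+ 2 * a00 <= r ^+ 2 * Lambda by rewrite ler_wpM2l // sqr_ge0.
  rewrite -(ler_pM2l r0); nra.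
- have /andP[h _] := ell1 r (-1).
  have : 0 <= lambda * (r ^+ 2 + 2 * r * (-1) * t + (-1) ^+ 2 * r ^+ 2).
    by rewrite mulr_ge0 ?(ltW l0) //; nra.
  have : r ^+ 2 * a00 <= r ^+ 2 * Lambda by rewrite ler_wpM2l // sqr_ge0.
  rewrite -(ler_pM2l r0); nra.
Qed.

(** The scales are tied by [E ^+ 2 * de = eps ^+ 2]. The amplitude [E] blows up as [eta] tends to 0,
    yet the height of the barrier, of order [r * E], times the negative part of the operator, of
    order [E * de / r], stays below 1. This contradicts [U * U^p >= 1] when [U >= 1]; for [U < 1]
    one has [U^p >= 1]. *)
Lemma log_barrier_pos (R : realType) (n : nat)
    (Lambda p eta eps r T U S a0y ayy tr : R) :
  0 <= Lambda -> 0 < eta <= 1 -> -1 <= p <= 0 -> 0 < eps ->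
  eps * (1 + Lambda * (4 + 2 * n%:R)) = 1 ->
  1 <= r -> 0 <= T <= r -> a0y <= Lambda * r -> 0 <= ayy ->
  0 <= tr <= Lambda * n%:R -> 0 < U ->
  let E := eps / eta in let de := eta ^+ 2 in
  U < T * (E * ((r ^+ 2) `^ (- de) - S `^ (- de))) ->
  0 < 4 * (E * (- de * (r ^+ 2) `^ (- de - 1))) * a0y +
    4 * (T * (E * (- de * ((- de - 1) * (r ^+ 2) `^ (- de - 1 - 1))))) * ayy +
    2 * (T * (E * (- de * (r ^+ 2) `^ (- de - 1)))) * tr + U `^ p.
Proof.
move=> L_ge0 /andP[eta_gt0 eta_le1] /andP[p_ge p_le] eps_gt0 epsC r_ge1.
move=> /andP[T_ge0 T_le] b0y2 ayy_ge0 /andP[tr_ge0 btr2] U_gt0 E de uy.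
(* [4 * Lambda] comes from the mixed term and [2 * Lambda * n] from the trace; the [ayy] term has
   the good sign. *)
set C := Lambda * (4 + 2 * n%:R) in epsC.
have C_ge0 : 0 <= C by rewrite mulr_ge0 // addr_ge0 // mulr_ge0.
have de_gt0 : 0 < de by rewrite exprn_gt0.
have E_gt0 : 0 < E by rewrite divr_gt0.
have r_gt0 : 0 < r by lra.
have y2 : 1 <= r ^+ 2 by rewrite exprn_ege1.
rewrite ltNge; apply/negP.
set w := (r ^+ 2) `^ (- de - 1); set w2 := (r ^+ 2) `^ (- de - 1 - 1) => h.
have r2_gt0 : 0 < r ^+ 2 by rewrite exprn_gt0.
have w_gt0 : 0 < w by exact: powR_gt0.
have w2_gt0 : 0 < w2 by exact: powR_gt0.
set v := (r ^+ 2) `^ (- de) in uy.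
have v_gt0 : 0 < v by exact: powR_gt0.
have vE : v = r ^+ 2 * w.
  rewrite -[X in X * _](powRr1 (ltW r2_gt0)) -powRD ?(gt_eqF r2_gt0) ?implybT //.
  by congr (_ `^ _); ring.
have v_le1 : v <= 1 by rewrite -(powRr0 (r ^+ 2)); apply: (ler_powR y2); lra.
have up_le : U `^ p <= E * de * w * (r * C).
  have e1 : 0 <= 4 * (T * (E * (de * ((de + 1) * w2)))) * ayy.
    have de1 : 0 <= de + 1 by lra.
    apply: mulr_ge0 ayy_ge0; apply: mulr_ge0 => //; apply: mulr_ge0 => //.
    apply: mulr_ge0 (ltW E_gt0) _; apply: mulr_ge0 (ltW de_gt0) _.
    exact: mulr_ge0 de1 (ltW w2_gt0).
  have e2 : 4 * a0y + 2 * (T * tr) <= r * C.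
    have : T * tr <= r * (Lambda * n%:R) by apply: ler_pM.
    by rewrite /C; lra.
  have e3 : E * de * w * (4 * a0y + 2 * (T * tr)) <= E * de * w * (r * C).
    by rewrite (ler_pM2l (mulr_gt0 (mulr_gt0 E_gt0 de_gt0) w_gt0)).
  by move: h e1 e3; lra.
have EdE : E * de = eps * eta by rewrite /E /de; field; rewrite gt_eqF.
have upr : r * U `^ p <= eps * eta * v * C.
  by rewrite vE -EdE; have := ler_wpM2l (ltW r_gt0) up_le; lra.
have uy_le : U <= r * E * v.
  apply: ltW; apply: lt_le_trans uy _.
  apply: (le_trans (_ : _ <= T * (E * v))).
    by rewrite ler_wpM2l // ler_pM2l // gerBl powR_ge0.
  by rewrite -mulrA ler_wpM2r // (mulr_ge0 (ltW E_gt0) (ltW v_gt0)).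
have epsC1 : eps * C < 1 by lra.
have eps1 : eps <= 1 by have := mulr_ge0 (ltW eps_gt0) C_ge0; lra.
(* [U^p >= min 1 (1 / U)] because [-1 <= p <= 0]. *)
have [U1|U1] := leP 1 U.
  have : (U)^-1 <= U `^ p by rewrite -powR_inv1 ?(ltW U_gt0) //; exact: ler_powR.
  rewrite -(ler_pM2l U_gt0) divff ?gt_eqF // => h1.
  have h2 : U * U `^ p <= E * v * (r * U `^ p).
    have -> : E * v * (r * U `^ p) = r * E * v * U `^ p by ring.
    by rewrite ler_wpM2r // powR_ge0.
  have h3 : E * v * (r * U `^ p) <= E * v * (eps * eta * v * C).
    by rewrite (ler_pM2l (mulr_gt0 E_gt0 v_gt0)).
  have h4 : E * v * (eps * eta * v * C) = eps * (eps * C) * v * v.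
    by rewrite /E; field; rewrite gt_eqF.
  have : eps * (eps * C) * v * v < 1.
    have e1 : eps * (eps * C) < 1 by have := mulr_ge0 (ltW eps_gt0) C_ge0; nra.
    have e0 : 0 <= eps * (eps * C) by rewrite !mulr_ge0 // ltW.
    have : eps * (eps * C) * v <= eps * (eps * C) by rewrite ler_piMr.
    have : eps * (eps * C) * v * v <= eps * (eps * C) * v.
      by rewrite ler_piMr // mulr_ge0 // ltW.
    lra.
  lra.
have U01 : 0 < U <= 1 by rewrite U_gt0 ltW.
have h1 : 1 <= U `^ p by rewrite -[leLHS](powRr0 (U)); exact: ger_powR.
have h2 : eps * eta * v * C <= eps * C.
  have : eta * v <= 1 by rewrite mulr_ile1 // ltW.
  move=> ev; have -> : eps * eta * v * C = eps * C * (eta * v) by ring.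
  by rewrite ler_piMr // mulr_ge0 // ltW.
have : 1 <= r * U `^ p by apply: le_trans h1 _; rewrite ler_peMl // powR_ge0.
lra.
Qed.

(* [tr (A D^2 F) / F] for [F = t^al s^-be], where [P = 1 / t] and [Q = 1 / s]. *)
Definition brk (R : realType) (al be P Q a00 a0y ayy tr : R) :=
  al * (al - 1) * P ^+ 2 * a00 - 4 * al * be * P * Q * a0y +
  4 * be * (be + 1) * Q ^+ 2 * ayy - 2 * be * Q * tr.

(** For [Lambda = lambda] the function is t s^(-n/2), the Poisson kernel of the half-space up to a
    constant, and equality holds. *)
Lemma brk_sub_ge0 (R : realType) (n : nat) (lambda Lambda a t s a00 a0y ayy tr : R) :
  a = Lambda / lambda -> (0 < n)%N -> 0 < lambda -> lambda <= Lambda -> 0 < t -> t ^+ 2 <= s ->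
  elliptic n lambda Lambda t s a00 a0y ayy tr ->
  0 <= brk a (((n%:R + 1) * a - 1) / 2) t^-1 s^-1 a00 a0y ayy tr.
Proof.
move=> aE n_gt0 l0 leL t0 ts [ell1 _ ell3].
have s0 : 0 < s by apply: lt_le_trans ts; rewrite exprn_gt0.
pose P := t^-1; pose Q := s^-1; pose N : R := n%:R; pose b := ((N + 1) * a - 1) / 2.
rewrite -/P -/Q -/N -/b.
have P0 : 0 < P by rewrite invr_gt0.
have Q0 : 0 < Q by rewrite invr_gt0.
have N1 : 1 <= N by rewrite ler1n.
have N0 : N != 0 by rewrite gt_eqF //; lra.
have a1 : 1 <= a by rewrite aE ler_pdivlMr // mul1r.
have tP : t * P = 1 by rewrite divff // gt_eqF.
have sQ : s * Q = 1 by rewrite divff // gt_eqF.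
have LE : Lambda = a * lambda by rewrite aE divfK // gt_eqF.
have b0 : 0 <= b by rewrite /b; nra.
have PQ : Q <= P ^+ 2.
  have : P ^+ 2 * Q * t ^+ 2 <= P ^+ 2 * Q * s by rewrite ler_wpM2l // mulr_ge0 ?sqr_ge0 ?ltW.
  have -> : P ^+ 2 * Q * t ^+ 2 = Q * (t * P) ^+ 2 by ring.
  have -> : P ^+ 2 * Q * s = P ^+ 2 * (s * Q) by ring.
  by rewrite tP sQ expr1n !mulr1.
have nrm (x y : R) : (x * P) ^+ 2 + 2 * (x * P) * (y * Q) * t + (y * Q) ^+ 2 * s =
    x ^+ 2 * P ^+ 2 + (2 * x * y + y ^+ 2) * Q.
  transitivity (x ^+ 2 * P ^+ 2 + 2 * x * y * Q * (t * P) + y ^+ 2 * Q * (s * Q)).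
    by ring.
  by rewrite tP sQ; ring.
(* With [X = y / s] and [d = e_N / t - X], which are orthogonal, [brk] equals
   [k A(N X - d) - a A(X + (N - 1) / N d) - a / N A(d) - 2 b Q (tr A - Q A(y))];
   only the first term needs the lower bound on [A]. *)
have := ell1 (- 1 * P) ((N + 1) * Q); rewrite nrm => /andP[f1 _].
have := ell1 ((N - 1) / N * P) (N^-1 * Q); rewrite nrm => /andP[_ f2].
have := ell1 (1 * P) (- 1 * Q); rewrite nrm => /andP[_ f3].
have f4 : Q * tr - Q ^+ 2 * ayy <= Lambda * (N - 1) * Q.
  have := ell3; rewrite -(ler_pM2r (exprn_gt0 2 Q0)).
  have -> : (Lambda * s - ayy) * Q ^+ 2 = Lambda * Q * (s * Q) - Q ^+ 2 * ayy by ring.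
  have -> : (Lambda * n%:R - tr) * s * Q ^+ 2 = (Lambda * N - tr) * Q * (s * Q) by rewrite /N; ring.
  by rewrite sQ; lra.
pose k := a * (N ^+ 2 * a - N + 1) / N ^+ 2.
have k0 : 0 <= k.
  by rewrite divr_ge0 ?sqr_ge0 // mulr_ge0 //; nra.
have g1 := ler_wpM2l k0 f1.
have a0 : 0 <= a by lra.
have g2 := ler_wpM2l a0 f2.
have aN0 : 0 <= a / N by rewrite divr_ge0 //; lra.
have g3 := ler_wpM2l aN0 f3.
have b20 : 0 <= 2 * b by lra.
have g4 := ler_wpM2l b20 f4.
have fin : 0 <= Lambda * (a - 1) * (N - 1) / N ^+ 2 * (P ^+ 2 - Q).
  apply: mulr_ge0; last by rewrite subr_ge0.
  apply: divr_ge0; last exact: sqr_ge0.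
  apply: mulr_ge0; last by lra.
  by apply: mulr_ge0; lra.
rewrite -subr_ge0 in g1; rewrite -subr_ge0 in g2; rewrite -subr_ge0 in g3.
rewrite -subr_ge0 in g4.
have := addr_ge0 (addr_ge0 (addr_ge0 (addr_ge0 g1 g2) g3) g4) fin.
congr (0 <= _); rewrite LE /brk /k /b; field.
exact: N0.
Qed.

(* With [X = r / t], the first estimate controls the derivative of [brk] in its
   second parameter, the second one the corrector with one more power of [t]. *)
Lemma brk_diff_lower (R : realType) (n : nat) (lambda Lambda a b de t r a00 a0y ayy tr : R) :
  0 < lambda -> lambda <= Lambda -> 0 <= a -> 0 <= b -> 0 < de <= 1 -> 0 < t <= r ->
  elliptic n lambda Lambda t (r ^+ 2) a00 a0y ayy tr ->
  - (Lambda * (4 * a + 8 * b + 8) * (r / t) * (r ^+ 2)^-1) <=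
  (brk a b t^-1 (r ^+ 2)^-1 a00 a0y ayy tr -
   brk a (b + de) t^-1 (r ^+ 2)^-1 a00 a0y ayy tr) / de.
Proof.
move=> l0 leL a0 b0 /andP[de0 de1] /andP[t0 t_le] ell.
have r0 : 0 < r by lra.
have tb : - r <= t <= r by apply/andP; split; lra.
have [_ /andP[_ byy] /andP[b0y _] /andP[btr _]] := elliptic_bounds l0 r0 tb ell.
set Q := (r ^+ 2)^-1; set X := r / t.
have Q0 : 0 < Q by rewrite invr_gt0 exprn_gt0.
have X1 : 1 <= X by rewrite ler_pdivlMr // mul1r.
have L0 : 0 < Lambda by lra.
have tr0 : 0 <= tr by apply: le_trans btr; rewrite mulr_ge0 // ltW.
have -> : (brk a b t^-1 Q a00 a0y ayy tr - brk a (b + de) t^-1 Q a00 a0y ayy tr) / de =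
    Q * (4 * a * (a0y / t) - 4 * (2 * b + 1 + de) * (Q * ayy) + 2 * tr).
  by rewrite /brk; field; rewrite !gt_eqF.
rewrite -mulNr mulrC ler_pM2l //.
have e1 : - (Lambda * X) <= a0y / t.
  by rewrite /X mulrA -mulNr ler_pM2r ?invr_gt0.
have e2 : Q * ayy <= Lambda * X.
  apply: (@le_trans _ _ Lambda); last by rewrite ler_peMr // ltW.
  by rewrite /Q ler_pdivrMl ?exprn_gt0 // mulrC.
have e3 : 4 * a * - (Lambda * X) <= 4 * a * (a0y / t) by rewrite ler_wpM2l //; lra.
have e4 : 4 * (2 * b + 1 + de) * (Q * ayy) <= 4 * (2 * b + 2) * (Lambda * X).
  have LX : 0 <= Lambda * X by rewrite mulr_ge0 ?ltW //; lra.
  apply: (@le_trans _ _ (4 * (2 * b + 1 + de) * (Lambda * X))).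
    by rewrite ler_wpM2l //; lra.
  by rewrite ler_wpM2r //; lra.
lra.
Qed.

Lemma brk_corrector_lower (R : realType) (n : nat) (lambda Lambda a b t r a00 a0y ayy tr : R) :
  0 < lambda -> lambda <= Lambda -> 1 <= a -> 0 <= b -> 0 < t <= r ->
  elliptic n lambda Lambda t (r ^+ 2) a00 a0y ayy tr ->
  (lambda * (a * (a - 1)) * (r / t) - Lambda * (4 * a * b + 2 * b * n%:R)) * (r ^+ 2)^-1
  <= t / r * brk a b t^-1 (r ^+ 2)^-1 a00 a0y ayy tr.
Proof.
move=> l0 leL a1 b0 /andP[t0 t_le] ell.
have r0 : 0 < r by lra.
have tb : - r <= t <= r by apply/andP; split; lra.
have [/andP[b00 _] /andP[byy _] /andP[_ b0y] /andP[btr1 btr2]] := elliptic_bounds l0 r0 tb ell.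
set Q := (r ^+ 2)^-1; set X := r / t.
have Q0 : 0 < Q by rewrite invr_gt0 exprn_gt0.
have X0 : 0 < X by rewrite divr_gt0.
have tr1 : t / r <= 1 by rewrite ler_pdivrMr // mul1r.
have tr0 : 0 < t / r by rewrite divr_gt0.
have L0 : 0 < Lambda by lra.
have ayy0 : 0 <= ayy by apply: le_trans byy; rewrite mulr_ge0 ?sqr_ge0 ?ltW.
have -> : t / r * brk a b t^-1 Q a00 a0y ayy tr =
   (a * (a - 1) * X * a00 - 4 * a * b * (a0y / r) + 4 * b * (b + 1) * Q * (t / r) * ayy
      - 2 * b * (t / r * tr)) * Q.
  by rewrite /brk /Q /X; field; rewrite !gt_eqF.
rewrite ler_pM2r //.
have e1 : a * (a - 1) * X * lambda <= a * (a - 1) * X * a00.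
  by rewrite ler_wpM2l // mulr_ge0 ?(ltW X0) // mulr_ge0 //; lra.
have e2 : 4 * a * b * (a0y / r) <= 4 * a * b * Lambda.
  rewrite ler_wpM2l //; first by rewrite !mulr_ge0 //; lra.
  by rewrite ler_pdivrMr.
have e3 : 0 <= 4 * b * (b + 1) * Q * (t / r) * ayy.
  rewrite mulr_ge0 // mulr_ge0 ?(ltW tr0) // mulr_ge0 ?(ltW Q0) //.
  by rewrite !mulr_ge0 //; lra.
have e4 : 2 * b * (t / r * tr) <= 2 * b * (Lambda * n%:R).
  rewrite ler_wpM2l //; first lra.
  have trge : 0 <= tr by apply: le_trans btr1; rewrite mulr_ge0 // ltW.
  by apply: le_trans btr2; rewrite ler_piMl.
lra.
Qed.

(** * Points of the x_N axis and balls tangent to the plane x_N = 1 *)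

Section axis.
Context {R : realType} {n : nat} (N : 'I_n).
Implicit Types (x : 'rV[R]_n).

Definition axis_pt (a : R) : 'rV[R]_n := \row_k (a * (N == k)%:R).

Lemma axisN a : axis_pt a 0 N = a.
Proof. by rewrite mxE eqxx mulr1. Qed.

Lemma sqdist_axis a b : sqdist (axis_pt a) (axis_pt b) = (b - a) ^+ 2.
Proof.
rewrite /sqdist (bigD1 N) //= big1 => [|k kN]; first by rewrite !axisN addr0.
by rewrite !mxE eq_sym (negbTE kN) !mulr0 subrr expr0n.
Qed.

Lemma sqdist_ge0 (c x : 'rV[R]_n) : 0 <= sqdist c x.
Proof. by apply: sumr_ge0 => k _; exact: sqr_ge0. Qed.

Lemma sqr_last_le_sqdist (c x : 'rV[R]_n) : (x 0 N - c 0 N) ^+ 2 <= sqdist c x.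
Proof.
rewrite /sqdist (bigD1 N) //= lerDl.
by apply: sumr_ge0 => k _; exact: sqr_ge0.
Qed.

Lemma ball_ge1 (rho : R) x : 0 < rho -> sqdist (axis_pt (1 + rho)) x <= rho ^+ 2 ->
  1 <= x 0 N.
Proof.
move=> rho_gt0 xr; have := le_trans (sqr_last_le_sqdist _ _) xr.
by rewrite axisN; nra.
Qed.

Lemma ball_gt1 (rho : R) x : 0 < rho -> sqdist (axis_pt (1 + rho)) x < rho ^+ 2 ->
  1 < x 0 N.
Proof.
move=> rho_gt0 xr; have := le_lt_trans (sqr_last_le_sqdist _ _) xr.
by rewrite axisN; nra.
Qed.

(** Both sides are the squared distance from [x] to the x_N axis. *)
Lemma sqdist_axis_shift (c d : R) x :
  sqdist (axis_pt c) x - (x 0 N - c) ^+ 2 = sqdist (axis_pt d) x - (x 0 N - d) ^+ 2.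
Proof.
rewrite /sqdist (bigD1 N) //= [in RHS](bigD1 N) //= !axisN.
rewrite [LHS]addrAC subrr add0r [RHS]addrAC subrr add0r.
apply: eq_bigr => k kN; congr ((_ - _) ^+ 2).
by rewrite !mxE eq_sym (negbTE kN) !mulr0.
Qed.

End axis.

(** * Estimates for solutions *)

Section halfspace_solution.
Context {R : realType} {n : nat} (N : 'I_n).
Hypothesis Nlast : N.+1 = n.
Variables (lambda Lambda p : R) (u : 'rV[R]_n -> R).
Implicit Types (x y : 'rV[R]_n).
Hypotheses (lambda_gt0 : 0 < lambda) (leL : lambda <= Lambda).
Hypothesis sol : positive_viscosity_solution lambda Lambda p u.
Local Notation axis := (axis_pt N).

Lemma u_gt0 x : 0 < x 0 N -> 0 < u x.
Proof. by move=> xN; have [+ _ _] := sol; apply; apply/(halfspaceE Nlast). Qed.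

(** Exponent of the radial barrier: [gam * lambda = n * Lambda] lets the radial second derivative
    outweigh the trace term for every admissible matrix. *)
Let gam := n%:R * (Lambda / lambda).

(** * Lower bounds on balls, and the range 0 < p <= 1 *)

Lemma ball_barrier (rho m : R) x : 0 < rho -> 0 < m ->
  (forall x, sqdist (axis (1 + rho)) x = rho ^+ 2 / 16 -> m <= u x) ->
  rho ^+ 2 / 16 <= sqdist (axis (1 + rho)) x <= rho ^+ 2 ->
  m * (rho ^+ 2 / 16) `^ gam * (sqdist (axis (1 + rho)) x `^ (- gam) -
    (rho ^+ 2) `^ (- gam)) <= u x.
Proof.
move=> rho_gt0 m_gt0 um /andP[xl xr]; rewrite leNgt; apply/negP => ux.
set c := axis (1 + rho) in um xl xr ux *.
(* With this factor the barrier is at most [m] on the inner sphere and vanishes on the outer one,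
   where [u > 0] suffices. *)
set k := m * _ in ux.
have r2 : 0 < rho ^+ 2 / 16 by nra.
have k_gt0 : 0 < k by rewrite mulr_gt0 // powR_gt0.
have n_gt0 : 0 < n%:R :> R by rewrite ltr0n -Nlast.
have gam_gt0 : 0 < gam by rewrite mulr_gt0 // divr_gt0 // (lt_le_trans lambda_gt0).
pose U := [set x : 'rV[R]_n | 0 < x 0 N /\ 0 < sqdist c x].
have hess := @ts_hess_mul _ _ N c U (fun=> 1) _ _ _ _ _ (@open_ts R n N c 0 0)
  (fun x _ => C2_at_cst 1 (x 0 N))
  (fun x Ux => C2_atZ k (C2_atD (C2_at_powR (- gam) (proj2 Ux))
      (C2_at_cst (- (rho ^+ 2) `^ (- gam)) _))).
have [||y yb|||] := viscosity_touch Nlast leL sol hess (t0 := 1)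
  (s1 := rho ^+ 2 / 16) (s2 := rho ^+ 2) (xb := x).
- by [].
- by move=> y [y1 y2 _]; split; [exact: lt_le_trans y1|exact: lt_le_trans y2].
- rewrite mul1r => uy; have [y1 y2 y3] := yb.
  have uy0 : 0 < u y by apply: u_gt0; exact: lt_le_trans y1.
  have ylt : sqdist c y < rho ^+ 2.
    rewrite lt_neqAle y3 andbT; apply/eqP => yE.
    by move: uy; rewrite yE subrr mulr0; lra.
  split=> //; first exact: ball_gt1 ylt.
  rewrite lt_neqAle y2 andbT; apply/eqP => yE.
  have := um y (esym yE); rewrite leNgt => /negP; apply.
  apply: lt_le_trans uy _; rewrite -yE mulrBr /k -mulrA.
  rewrite -powRD ?subrr ?powRr0; last by rewrite (gt_eqF r2) implybT.
  by rewrite mulr1 gerBl mulr_ge0 ?powR_ge0 // mulr_ge0 ?powR_ge0 // ltW.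
- by split=> //; exact: ball_ge1 xr.
- by rewrite mul1r.
move=> y [a00 [a0y [ayy [tr [[y1 y2 y3] uy [ell1 /andP[_ tr_le] _]]]]]].
rewrite !mul0r !mulr0 !mul0r !add0r !mul1r addr0 addr0.
have s_gt0 : 0 < sqdist c y by exact: lt_le_trans y2.
have up : 0 < u y `^ p by apply: powR_gt0; apply: u_gt0; exact: lt_le_trans y1.
have := ell1 0 1; rewrite !expr0n !expr1n /= !mulr0 !mul0r !add0r !mul1r => /andP[ayy_ge _].
have sE : sqdist c y `^ (- gam - 1) = sqdist c y * sqdist c y `^ (- gam - 1 - 1).
  rewrite -[X in X * _](powRr1 (ltW s_gt0)) -powRD ?(gt_eqF s_gt0) ?implybT //.
  by congr (_ `^ _); ring.
rewrite sE; set w := sqdist c y `^ (- gam - 1 - 1); set s := sqdist c y in s_gt0 ayy_ge *.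
have w_gt0 : 0 < w by exact: powR_gt0.
have gl : gam * lambda = n%:R * Lambda by rewrite /gam -mulrA divfK // gt_eqF.
apply/negP; rewrite -ltNge.
have : 0 <= 4 * (gam + 1) * ayy - 2 * s * tr.
  have : (gam + 1) * (lambda * s) <= (gam + 1) * ayy by rewrite ler_wpM2l //; lra.
  have : s * tr <= s * (Lambda * n%:R) by rewrite ler_pM2l.
  have : 0 <= lambda * s by rewrite mulr_ge0 // ltW.
  have -> : (gam + 1) * (lambda * s) = (gam * lambda) * s + lambda * s by ring.
  have L_ge0 : 0 <= Lambda by rewrite (le_trans (ltW lambda_gt0)).
  have : 0 <= n%:R * Lambda * s by rewrite mulr_ge0 ?(ltW s_gt0) // mulr_ge0.
  rewrite gl; lra.
move=> h; have : 0 <= k * gam * w * (4 * (gam + 1) * ayy - 2 * s * tr).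
  apply: mulr_ge0 h; apply: ltW; apply: mulr_gt0 w_gt0; exact: mulr_gt0.
lra.
Qed.

Lemma ball_bump (rho : R) x : 0 < rho ->
  sqdist (axis (1 + rho)) x <= rho ^+ 2 / 16 ->
  exists2 y, sqdist (axis (1 + rho)) y <= rho ^+ 2 / 4 &
    u y `^ p <= 16 * Lambda * n%:R * u x / rho ^+ 2.
Proof.
move=> rho_gt0 xr; set c := axis (1 + rho) in xr *.
set m := u x.
have r2 : 0 < rho ^+ 2 by rewrite exprn_gt0.
have x1 : 1 <= x 0 N by apply: (ball_ge1 rho_gt0); move: xr; rewrite -/c; lra.
have m_gt0 : 0 < m by apply: u_gt0; lra.
(* The paraboloid [2 * m + k * s] vanishes at radius [rho / 2] and is at least [3 / 2 * m] at [x],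
   so it exceeds [u] there and a contact point exists inside. *)
pose k := - (8 * m / rho ^+ 2).
have k_le0 : k <= 0 by rewrite oppr_le0 divr_ge0 ?mulr_ge0 // ltW.
have kr : k * (rho ^+ 2 / 4) = - (2 * m) by rewrite /k; field; rewrite gt_eqF.
have hess := @ts_hess_mul _ _ N c _ (fun=> 1) _ _ _ _ _ (@open_ts R n N c 0 (-1))
  (fun x _ => C2_at_cst 1 (x 0 N))
  (fun x Ux => C2_atD (C2_at_cst (2 * m) _) (C2_atZ k (C2_at_id _))).
have [||y yb|||] := viscosity_touch Nlast leL sol hess (t0 := 1)
  (s1 := -1) (s2 := rho ^+ 2 / 4) (xb := x).
- by [].
- move=> y [y1 _ _]; split; first exact: lt_le_trans y1.
  by apply: lt_le_trans (sqdist_ge0 _ _); lra.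
- rewrite mul1r => uy; have [y1 y2 y3] := yb.
  have uy0 : 0 < u y by apply: u_gt0; exact: lt_le_trans y1.
  have ylt : sqdist c y < rho ^+ 2 / 4.
    rewrite lt_neqAle y3 andbT; apply/eqP => yE.
    by move: uy; rewrite /= yE kr; lra.
  split=> //; first by apply: (ball_gt1 rho_gt0); move: ylt; rewrite -/c; lra.
  by apply: lt_le_trans (sqdist_ge0 _ _); lra.
- split=> //; first by apply: le_trans (sqdist_ge0 _ _); lra.
  by move: xr; lra.
- rewrite mul1r /= -/m.
  have : k * (rho ^+ 2 / 16) <= k * sqdist c x by rewrite ler_wnM2l.
  by move: kr m_gt0; lra.
move=> y [a00 [a0y [ayy [tr [[y1 y2 y3] uy [ell1 /andP[tr_ge tr_le] _]]]]]] h.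
exists y => //.
have h' : u y `^ p <= (- 2 * k) * tr by move: h; lra.
apply: (le_trans h'); have -> : 16 * Lambda * n%:R * m / rho ^+ 2 = (- 2 * k) * (Lambda * n%:R).
  by rewrite /k; field; rewrite gt_eqF.
by rewrite ler_wpM2l //; lra.
Qed.

Lemma gam_ge1 : 1 <= gam.
Proof.
rewrite -[1]mulr1 ler_pM // ?ler1n ?ler_pdivlMr ?mul1r //.
by rewrite -Nlast.
Qed.

(** Decay of s^(-gam) when the radius doubles: a barrier normalised to 1 at radius [rho / 4] is [q]
    at [rho / 2] and [q ^+ 2] at [rho], whence the factor [q * (1 - q)] below. *)
Definition barrier_ratio := 4^-1 `^ gam.

Lemma barrier_ratio_gt0 : 0 < barrier_ratio.
Proof. by rewrite powR_gt0. Qed.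

Lemma barrier_ratio_le : barrier_ratio <= 4^-1.
Proof. by apply: ge1r_powR gam_ge1; lra. Qed.

Lemma ball_estimate (rho : R) : 0 < rho ->
  let q := barrier_ratio in exists x,
  [/\ sqdist (axis (1 + rho)) x <= rho ^+ 2 / 16, 0 < u x,
      0 <= p -> (u x * (q * (1 - q))) `^ p <= 16 * Lambda * n%:R * u x / rho ^+ 2 &
      2 <= rho -> u x * q ^+ 2 / rho <= u (axis 2)].
Proof.
move=> rho_gt0 q; set c := axis (1 + rho).
have q_gt0 : 0 < q := barrier_ratio_gt0.
have q_le : q <= 4^-1 := barrier_ratio_le.
have r2 : 0 < rho ^+ 2 by rewrite exprn_gt0.
have box x : sqdist c x <= rho ^+ 2 / 16 -> tsbox N c 1 (-1) (rho ^+ 2 / 16) x.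
  move=> xr; split=> //; first by apply: (ball_ge1 rho_gt0); move: xr; rewrite -/c; lra.
  by apply: le_trans (sqdist_ge0 _ _); lra.
have [||x [x1 _ xr] xmin] := solution_min Nlast (c := c) (t0 := 1) (s1 := -1)
    (s2 := rho ^+ 2 / 16) sol => //.
  by exists c; apply: box; rewrite sqdist_axis subrr expr0n /=; lra.
have m_gt0 : 0 < u x by apply: u_gt0; exact: lt_le_trans x1.
have barrier y : rho ^+ 2 / 16 <= sqdist c y <= rho ^+ 2 ->
    u x * ((rho ^+ 2 / 16 / sqdist c y) `^ gam - q ^+ 2) <= u y.
  move=> yr; have /andP[yl _] := yr.
  have s_gt0 : 0 < sqdist c y by apply: lt_le_trans yl; lra.
  apply: le_trans (ball_barrier rho_gt0 m_gt0 _ yr); last first.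
    by move=> z zr; apply: xmin; apply: box; rewrite -/c zr.
  rewrite -/c -(mulrA (u x)) ler_pM2l // mulrBr -!powR_div //; [|lra..].
  rewrite lerD2l lerN2 mulrAC divff ?gt_eqF // mul1r.
  rewrite expr2 /q /barrier_ratio -powRM //.
  by rewrite -invfM -natrM.
exists x; split=> //.
(* The contact point of the paraboloid lies within radius [rho / 2], where the barrier bounds [u]
   below by a fixed fraction of its minimum; [p >= 0] transfers this to the power. *)
- move=> p_ge0; have [y yr yp] := ball_bump rho_gt0 xr.
  apply: le_trans yp; apply: ge0_ler_powR => //; rewrite ?nnegrE.
  + by rewrite ltW // !mulr_gt0 //; lra.
  + apply/ltW/u_gt0; apply: (lt_le_trans ltr01); apply: (ball_ge1 rho_gt0).
    by move: yr; rewrite -/c; lra.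
  have [ys|ys] := leP (sqdist c y) (rho ^+ 2 / 16).
    apply: le_trans (xmin y (box y ys)); rewrite ger_pMr //; nra.
  apply: le_trans (barrier y _); last by rewrite -/c; apply/andP; split; lra.
  rewrite ler_pM2l // mulrBr mulr1 -expr2 lerD2r; apply: ge0_ler_powR.
  + exact: le_trans gam_ge1.
  + by rewrite nnegrE.
  + by rewrite nnegrE divr_ge0 // ?sqdist_ge0 //; lra.
  + by rewrite ler_pdivlMr; [lra|apply: lt_trans ys; lra].
(* The point [axis 2] is at distance 1 from the outer sphere, where the barrier is still of order
   [u x / rho]. *)
- move=> rho_ge2; have s2 : sqdist c (axis 2) = (rho - 1) ^+ 2.
    by rewrite sqdist_axis; ring.
  have r1 : 0 < (rho - 1) ^+ 2 by rewrite exprn_gt0 //; lra.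
  apply: le_trans (barrier (axis 2) _); last first.
    by rewrite s2; apply/andP; split; nra.
  rewrite s2 -mulrA ler_pM2l //.
  have -> : rho ^+ 2 / 16 / (rho - 1) ^+ 2 = 4^-1 * 4^-1 * (rho ^+ 2 / (rho - 1) ^+ 2).
    by field; rewrite gt_eqF //; lra.
  have w_ge0 : 0 <= rho ^+ 2 / (rho - 1) ^+ 2 by rewrite divr_ge0 // ltW.
  rewrite (powRM _ _ w_ge0) // [(4^-1 * 4^-1) `^ _]powRM //.
  rewrite -/barrier_ratio -/q -expr2.
  have w_ge : 1 + rho^-1 <= rho ^+ 2 / (rho - 1) ^+ 2.
    rewrite ler_pdivlMr // -(ler_pM2l rho_gt0).
    have -> : rho * ((1 + rho^-1) * (rho - 1) ^+ 2) = (rho + 1) * (rho - 1) ^+ 2.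
      by field; rewrite gt_eqF.
    nra.
  have w_le : rho ^+ 2 / (rho - 1) ^+ 2 <= (rho ^+ 2 / (rho - 1) ^+ 2) `^ gam.
    apply: le1r_powR gam_ge1; apply: le_trans w_ge; rewrite lerDl invr_ge0 ltW //.
  rewrite -{3}[q ^+ 2]mulr1 -mulrBr ler_pM2l ?exprn_gt0 //.
  by rewrite lerBrDl; exact: le_trans w_ge w_le.
Qed.

Lemma no_solution_p01 : 0 < p <= 1 -> False.
Proof.
move=> /andP[p_gt0 p_le1].
pose q := barrier_ratio.
have q_gt0 : 0 < q := barrier_ratio_gt0.
have q_le : q <= 4^-1 := barrier_ratio_le.
pose K := (q * (1 - q)) `^ p.
have K_gt0 : 0 < K by rewrite powR_gt0 // mulr_gt0 //; lra.
pose C := 16 * Lambda * n%:R.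
have C_ge0 : 0 <= C by rewrite !mulr_ge0 // (le_trans (ltW lambda_gt0)).
pose D := u (axis 2) / q ^+ 2.
have D_gt0 : 0 < D by rewrite divr_gt0 ?exprn_gt0 // u_gt0 // axisN.
(* The two ball estimates give [rho * K <= C * (1 + D)], since [m^(1 - p)] is at most the larger of
   1 and [m]; this radius violates it. *)
pose rho := 2 + C * (1 + D) / K.
have rho_ge2 : 2 <= rho by rewrite lerDl divr_ge0 ?(ltW K_gt0) // mulr_ge0 //; lra.
have rho_gt0 : 0 < rho by lra.
have [x [_ m_gt0 /(_ (ltW p_gt0)) h1 /(_ rho_ge2) h2]] :=
  ball_estimate rho_gt0.
set m := u x in m_gt0 h1 h2; rewrite -/q in h1 h2.
have mD : m <= D * rho.
  by rewrite /D mulrAC ler_pdivlMr ?exprn_gt0 // -ler_pdivrMr.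
have m1p : m `^ (1 - p) <= (1 + D) * rho.
  have [m1|m1] := leP 1 m.
    apply: le_trans (ler1_powR m1 _) _; first lra.
    by apply: (le_trans mD); nra.
  apply: le_trans (_ : 1 <= _); last nra.
  have m01 : 0 < m <= 1 by rewrite m_gt0 ltW.
  have p0 : 0 <= 1 - p by lra.
  by rewrite -[leRHS](powRr0 m); exact: ger_powR.
have : rho ^+ 2 * K <= C * ((1 + D) * rho).
  apply: le_trans (_ : C * m `^ (1 - p) <= _); last by rewrite ler_wpM2l.
  rewrite -(ler_pM2r (powR_gt0 p m_gt0)) -[leRHS]mulrA -powRD; last first.
    by rewrite (gt_eqF m_gt0) implybT.
  rewrite subrK powRr1 ?(ltW m_gt0) //.
  move: h1; rewrite powRM ?(ltW m_gt0) //; last by rewrite mulr_ge0 //; lra.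
  by rewrite ler_pdivlMr ?exprn_gt0 // -/K -/C; lra.
have : rho * K > C * (1 + D).
  rewrite /rho mulrDl divfK ?gt_eqF //; lra.
move=> h3 h4; have : rho * (C * (1 + D)) < rho * (rho * K) by rewrite ltr_pM2l.
by move: h4; lra.
Qed.

(** * The range -1 <= p <= 0 *)

Lemma log_barrier (eta S : R) : 0 < eta <= 1 -> -1 <= p <= 0 ->
  let eps := (1 + Lambda * (4 + 2 * n%:R))^-1 in
  4 <= S ->
  eps / eta * (4 `^ (- eta ^+ 2) - S `^ (- eta ^+ 2)) <= u (axis 2).
Proof.
move=> /andP[eta_gt0 eta_le1] /andP[p_ge p_le] eps S4; rewrite leNgt; apply/negP => ux.
pose C := Lambda * (4 + 2 * n%:R).
have L_gt0 : 0 < Lambda by exact: lt_le_trans leL.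
have C_ge0 : 0 <= C by rewrite mulr_ge0 ?(ltW L_gt0) // addr_ge0 // mulr_ge0.
have eps_gt0 : 0 < eps by rewrite invr_gt0 -/C; lra.
have epsC : eps * (1 + C) = 1 by rewrite mulVf // gt_eqF // -/C; lra.
set de := eta ^+ 2 in ux *.
have de_gt0 : 0 < de by rewrite exprn_gt0.
set E := eps / eta in ux *.
have E_gt0 : 0 < E by rewrite divr_gt0.
(* The barrier vanishes on the plane x_N = 1 and on the sphere [s = S], so positivity of [u] is all
   that is needed there; the bound to be refuted is its value at [axis 2]. *)
have hess := @ts_hess_mul _ _ N 0 _ (fun t => t - 1) _ _ _ _ _ (@open_ts R n N 0 0 0)
  (fun x _ => C2_atD (C2_at_id (x 0 N)) (C2_at_cst (- 1) (x 0 N)))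
  (fun x Ux => C2_atZ E (C2_atD (C2_at_powR (- de) (proj2 Ux))
      (C2_at_cst (- S `^ (- de)) _))).
have s2 : sqdist 0 (axis 2) = 4 :> R.
  have -> : 0 = axis 0 :> 'rV[R]_n by apply/rowP => k; rewrite !mxE mul0r.
  by rewrite sqdist_axis; ring.
have N_ge1 y : 1 <= y 0 N -> 1 <= sqdist 0 y.
  by move=> y1; apply: le_trans (sqr_last_le_sqdist N 0 y); rewrite mxE subr0; nra.
have [||y yb|||] := viscosity_touch Nlast leL sol hess (t0 := 1)
  (s1 := 1) (s2 := S) (xb := axis 2).
- by [].
- by move=> y [y1 y2 _]; split; [exact: lt_le_trans y1|exact: lt_le_trans y2].
- move=> uy; have [y1 y2 y3] := yb.
  have uy0 : 0 < u y by apply: u_gt0; exact: lt_le_trans y1.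
  have yN : 1 < y 0 N.
    rewrite lt_neqAle y1 andbT; apply/eqP => yE.
    by move: uy; rewrite -yE subrr mul0r; lra.
  split=> //.
    by apply: lt_le_trans (sqr_last_le_sqdist N 0 y); rewrite mxE subr0; nra.
  rewrite lt_neqAle y3 andbT; apply/eqP => yE.
  by move: uy; rewrite yE subrr !mulr0; lra.
- by split; rewrite ?axisN ?s2 // ler1n.
- have one : 2 - 1 = 1 :> R by ring.
  by rewrite axisN s2 one mul1r.
clear hess s2 N_ge1 => y [a00 [a0y [ayy [tr [[y1 y2 y3] uy ell]]]]].
pose r := Num.sqrt (sqdist 0 y).
have s_gt0 : 0 < sqdist 0 y by exact: lt_le_trans y2.
have rE : sqdist 0 y = r ^+ 2 by rewrite sqr_sqrtr // ltW.
have r_ge1 : 1 <= r by rewrite -sqrtr1; apply: ler_wsqrtr.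
have tr_le : y 0 N <= r.
  have := sqr_last_le_sqdist N 0 y; rewrite mxE subr0 rE; nra.
move: ell uy y2 y3; rewrite rE mxE subr0 => ell uy y2 y3.
have r_gt0 : 0 < r by lra.
have tr_b : - r <= y 0 N <= r by apply/andP; split; lra.
have [b00 /andP[byy1 byy2] /andP[b0y1 b0y2] /andP[btr1 btr2]] :=
  elliptic_bounds lambda_gt0 r_gt0 tr_b ell.
have U_gt0 : 0 < u y by apply: u_gt0; exact: lt_le_trans y1.
rewrite !addr0 !mul0r add0r !mul1r; apply/negP; rewrite -ltNge.
have eta01 : 0 < eta <= 1 by rewrite eta_gt0.
have p01 : -1 <= p <= 0 by rewrite p_ge.
have T_b : 0 <= y 0 N - 1 <= r by apply/andP; split; lra.
have ayy_ge0 : 0 <= ayy by apply: le_trans byy1; rewrite mulr_ge0 ?sqr_ge0 // ltW.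
have tr_bd : 0 <= tr <= Lambda * n%:R.
  by rewrite btr2 andbT; apply: le_trans btr1; rewrite mulr_ge0 // ltW.
exact: (log_barrier_pos (ltW L_gt0) eta01 p01 eps_gt0 epsC r_ge1 T_b b0y2
  ayy_ge0 tr_bd U_gt0 uy).
Qed.

Lemma no_solution_pN10 : -1 <= p <= 0 -> False.
Proof.
move=> p_le; pose eps := (1 + Lambda * (4 + 2 * n%:R))^-1 : R.
have eps_gt0 : 0 < eps.
  have n0 : 0 <= 4 + 2 * n%:R :> R by have := ler0n R n; lra.
  have := mulr_ge0 (le_trans (ltW lambda_gt0) leL) n0.
  by rewrite invr_gt0; lra.
pose v := u (axis 2); have v_gt0 : 0 < v by rewrite u_gt0 // axisN.
(* This makes [eps / eta = 8 * v + eps]. The choice of [S] below halves 4^(-de), which is at least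
   1/4, so the barrier exceeds [v] at [axis 2]. *)
pose eta := eps / (8 * v + eps).
have den_gt0 : 0 < 8 * v + eps by lra.
have eta_gt0 : 0 < eta by rewrite divr_gt0.
have eta_le1 : eta <= 1 by rewrite ler_pdivrMr // mul1r; lra.
have e01 : 0 < eta <= 1 by rewrite eta_gt0.
set de := eta ^+ 2; have de_gt0 : 0 < de by rewrite exprn_gt0.
have S4 : 4 <= 4 * 2 `^ de^-1 :> R.
  rewrite ler_peMr // -[leLHS](powRr0 2); apply: ler_powR; first lra.
  by rewrite invr_ge0 ltW.
have := log_barrier e01 p_le S4; rewrite -/eps -/de -/v.
apply/negP; rewrite -ltNge.
rewrite powRM ?powR_ge0 // -powRrM mulrN mulVf ?gt_eqF // powR_inv1 //.
have w_ge : 4^-1 <= 4 `^ (- de) :> R.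
  rewrite -powR_inv1 //; apply: ler_powR; first lra.
  by rewrite lerN2 /de expr2 mulr_ile1 // ltW.
have -> : eps / eta = 8 * v + eps by rewrite /eta; field; rewrite !gt_eqF.
by move: w_ge; set w := 4 `^ (- de); nra.
Qed.

(** * The range p > 1 up to the critical exponent *)

Hypothesis n_gt1 : (1 < n)%N.

Let a := Lambda / lambda.
Let nu := n%:R * a - 1.
Let b := ((n%:R + 1) * a - 1) / 2.
Local Notation e := (axis 1).

Let a_ge1 : 1 <= a.
Proof. by rewrite ler_pdivlMr // mul1r. Qed.

Let n_ge2 : 2 <= n%:R :> R.
Proof. by rewrite ler_nat. Qed.

Let nu_gt0 : 0 < nu.
Proof. by rewrite /nu; move: a_ge1 n_ge2; nra. Qed.

Let b_gt0 : 0 < b.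
Proof. by rewrite /b; move: a_ge1 n_ge2; nra. Qed.

Definition Phi (t s : R) := t `^ a * s `^ (- b).

Lemma Phi_le_t t s : 0 < t -> 1 <= s -> Phi t s <= t `^ a.
Proof.
move=> t0 s1; rewrite /Phi ger_pMr ?powR_gt0 // -[leRHS](powRr0 s).
by apply: (ler_powR s1); rewrite oppr_le0 ltW.
Qed.

Lemma Phi_le_s t s : 0 < t -> t ^+ 2 <= s -> Phi t s <= s `^ (- (nu / 2)).
Proof.
move=> t0 ts; have s0 : 0 < s by apply: lt_le_trans ts; rewrite exprn_gt0.
have -> : - (nu / 2) = a / 2 + - b by rewrite /b /nu; field.
rewrite powRD ?(gt_eqF s0) ?implybT // ler_pM2r ?powR_gt0 //.
have -> : t `^ a = (t ^+ 2) `^ (a / 2).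
  by rewrite -powR_mulrn ?(ltW t0) // -powRrM; congr (_ `^ _); field.
apply: ge0_ler_powR => //; rewrite ?nnegrE ?sqr_ge0 ?(ltW s0) //.
by move: a_ge1; lra.
Qed.

Section psi.
Variables (k1 k2 k3 de : R).

(** With [k2 = - k1] the first line is a difference quotient of [Phi] in the exponent of [s], with
    limit a multiple of [Phi log s]; the [k3] term is the corrector, of the same homogeneity as
    [Phi]. *)
Definition psi (x : 'rV[R]_n) : R :=
  (x 0 N - 1) `^ a * (k1 * sqdist e x `^ (- b) + k2 * sqdist e x `^ (- (b + de))) +
  (x 0 N - 1) `^ (a + 1) * (k3 * sqdist e x `^ (- (b + 2^-1))).

Lemma psi_hess : exists ctt cts css cs,
  ts_hess N e [set x : 'rV[R]_n | 1 < x 0 N /\ 0 < sqdist e x] psi ctt cts css cs /\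
  forall x, 1 < x 0 N -> 0 < sqdist e x -> forall a00 a0y ayy tr,
    let t := x 0 N - 1 in let s := sqdist e x in
    ctt x * a00 + 4 * cts x * a0y + 4 * css x * ayy + 2 * cs x * tr =
    t `^ a * (k1 * s `^ (- b) * brk a b t^-1 s^-1 a00 a0y ayy tr +
       k2 * s `^ (- (b + de)) * brk a (b + de) t^-1 s^-1 a00 a0y ayy tr) +
    t `^ (a + 1) * (k3 * s `^ (- (b + 2^-1))
       * brk (a + 1) (b + 2^-1) t^-1 s^-1 a00 a0y ayy tr).
Proof.
pose U := [set x : 'rV[R]_n | 1 < x 0 N /\ 0 < sqdist e x].
have t_gt0 x : U x -> 0 < x 0 N - 1 by move=> [x1 _]; rewrite subr_gt0.
have oU : open U := @open_ts R n N e 1 0.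
have h1 := @ts_hess_mul _ _ N e U _ _ _ _ _ _ oU
  (fun x Ux => C2_at_shift (C2_at_powR a (t_gt0 x Ux)))
  (fun x Ux => C2_atD (C2_atZ k1 (C2_at_powR (- b) (proj2 Ux)))
                      (C2_atZ k2 (C2_at_powR (- (b + de)) (proj2 Ux)))).
have h2 := @ts_hess_mul _ _ N e U _ _ _ _ _ _ oU
  (fun x Ux => C2_at_shift (C2_at_powR (a + 1) (t_gt0 x Ux)))
  (fun x Ux => C2_atZ k3 (C2_at_powR (- (b + 2^-1)) (proj2 Ux))).
do 4 eexists; split; first exact: ts_hessD h1 h2.
move=> x x1 s0 a00 a0y ayy tr t s /=; rewrite -/t -/s.
have t0 : 0 < t by rewrite subr_gt0.
rewrite !(powR_subr1 _ t0) !(powR_subr1 _ s0) /brk.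
by ring.
Qed.

Lemma psi_le x : 0 <= k1 -> k2 <= 0 -> 0 <= k3 -> 1 < x 0 N -> 1 <= sqdist e x ->
  psi x <= (k1 + k3) * Phi (x 0 N - 1) (sqdist e x).
Proof.
move=> k1_ge0 k2_le0 k3_ge0 x1 s1.
have := sqr_last_le_sqdist N e x; rewrite axisN.
set t := x 0 N - 1; set s := sqdist e x in s1 * => ts.
have t0 : 0 < t by rewrite subr_gt0.
have s0 : 0 < s by lra.
rewrite /psi -/t -/s mulrDl mulrDr; apply: lerD; last first.
  rewrite mulrCA ler_wpM2l // /Phi opprD powRD ?(gt_eqF t0) ?implybT //.
  rewrite powRr1 ?(ltW t0) // powRD ?(gt_eqF s0) ?implybT //.
  rewrite -mulrA ler_pM2l ?powR_gt0 // mulrCA ger_pMr ?powR_gt0 //.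
  rewrite powRN ler_pdivrMr ?powR_gt0 // mul1r powR12_sqrt ?(ltW s0) //.
  by rewrite -(ler_sqr (ltW t0)) ?nnegrE ?sqrtr_ge0 // sqr_sqrtr // ltW.
rewrite mulrCA -/(Phi t s) gerDl mulr_ge0_le0 ?powR_ge0 //.
by rewrite mulr_le0_ge0 // powR_ge0.
Qed.

(** Near [t = 0] and at infinity [psi] is bounded above by a multiple of [Phi], which tends to 0,
    while [u] is positive; hence only the unit half-sphere carries a boundary assumption. *)
Lemma quarter_comparison :
  0 <= k1 -> k2 <= 0 -> 0 <= k3 ->
  (forall x, 1 < x 0 N -> sqdist e x = 1 -> psi x <= u x) ->
  (forall x a00 a0y ayy tr, 1 < x 0 N -> 1 < sqdist e x ->
    let t := x 0 N - 1 in let s := sqdist e x in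
    elliptic n lambda Lambda t s a00 a0y ayy tr ->
    0 < t `^ a * (k1 * s `^ (- b) * brk a b t^-1 s^-1 a00 a0y ayy tr +
       k2 * s `^ (- (b + de)) * brk a (b + de) t^-1 s^-1 a00 a0y ayy tr) +
    t `^ (a + 1) * (k3 * s `^ (- (b + 2^-1))
       * brk (a + 1) (b + 2^-1) t^-1 s^-1 a00 a0y ayy tr) + u x `^ p) ->
  forall x, 1 < x 0 N -> 1 <= sqdist e x -> psi x <= u x.
Proof.
move=> k1_ge0 k2_le0 k3_ge0 bdry sub x x1 s1; rewrite leNgt; apply/negP => ux.
have ux_gt0 : 0 < u x by apply: u_gt0; lra.
(* Subtracting [ka] keeps the points where the test function exceeds [u] away
   from [t = 0] and from infinity. *)
pose ka := (psi x - u x) / 2.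
have ka_gt0 : 0 < ka by rewrite divr_gt0 // subr_gt0.
pose M := k1 + k3.
have M_gt0 : 0 < M.
  rewrite lt_neqAle addr_ge0 // andbT; apply/eqP => M0.
  have := psi_le k1_ge0 k2_le0 k3_ge0 x1 s1.
  by rewrite -/M -M0 mul0r; lra.
pose q := ka / M.
have q_gt0 : 0 < q by rewrite divr_gt0.
(* These solve [t0^a = q] and [S^(- nu / 2) = q], the thresholds at which the two upper bounds on
   [Phi] reach [q]. *)
pose t0 := q `^ a^-1; pose S := q `^ (- (nu / 2)^-1).
have t0_gt0 : 0 < t0 by exact: powR_gt0.
have a_gt0 : 0 < a by move: a_ge1; lra.
have inside y : 1 < y 0 N -> 1 <= sqdist e y -> u y < psi y - ka ->
    1 + t0 < y 0 N /\ sqdist e y < S.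
  move=> y1 sy uy; have uy0 : 0 < u y by apply: u_gt0; lra.
  have := psi_le k1_ge0 k2_le0 k3_ge0 y1 sy; rewrite -/M => psi_y.
  have yt : 0 < y 0 N - 1 by rewrite subr_gt0.
  have qP : q < Phi (y 0 N - 1) (sqdist e y).
    by rewrite ltr_pdivrMr // mulrC; lra.
  split.
    have /(lt_le_trans qP) h := Phi_le_t yt sy.
    rewrite addrC -ltrBrDr.
    have := gt0_ltr_powR (_ : 0 < a^-1) _ _ h; rewrite !nnegrE invr_gt0.
    move=> /(_ a_gt0 (ltW q_gt0) (powR_ge0 _ _)); rewrite -powRrM divff ?gt_eqF //.
    by rewrite powRr1 // ltW.
  have := sqr_last_le_sqdist N e y; rewrite axisN => /(Phi_le_s yt) /(lt_le_trans qP) h.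
  have s0 : 0 < sqdist e y by lra.
  rewrite ltNge; apply/negP => Ss.
  have nu2 : 0 < nu / 2 by move: nu_gt0; lra.
  have : (sqdist e y) `^ (- (nu / 2)) <= S `^ (- (nu / 2)).
    rewrite !powRN lef_pV2 ?posrE ?powR_gt0 //; apply: ge0_ler_powR => //.
    + by rewrite ltW.
    + by rewrite nnegrE powR_ge0.
    + by rewrite nnegrE ltW.
  by rewrite /S -powRrM mulrNN mulVf ?gt_eqF // powRr1 ?(ltW q_gt0) //; lra.
have [ctt [cts [css [cs [hess hessE]]]]] := psi_hess.
have oU : open [set x : 'rV[R]_n | 1 < x 0 N /\ 0 < sqdist e x] := @open_ts R n N e 1 0.
have uxka : u x < psi x - ka by rewrite /ka; lra.
have [x1' x2'] := inside x x1 s1 uxka.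
have [||y yb uy|||] := viscosity_touch Nlast leL sol
  (ts_hessD hess (ts_hess_cst N e (- ka) oU)) (t0 := 1 + t0) (s1 := 1) (s2 := S) (xb := x).
- by lra.
- by move=> y [y1 y2 _]; split; lra.
- have [y1 y2 y3] := yb.
  have y1' : 1 < y 0 N by lra.
  have [yt ys] := inside y y1' y2 uy; split=> //.
  rewrite lt_neqAle y2 andbT; apply/eqP => s1y.
  by have := bdry y y1' (esym s1y); lra.
- by split=> //; exact: ltW.
- by [].
move=> y [a00 [a0y [ayy [tr [[y1 y2 y3] uy]]]]]; rewrite axisN !addr0 => ell.
have y1' : 1 < y 0 N by lra.
have [yt ys] := inside y y1' y2 uy.
have y2' : 1 < sqdist e y.
  rewrite lt_neqAle y2 andbT; apply/eqP => s1y.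
  by have := bdry y y1' (esym s1y); lra.
rewrite hessE //; last by lra.
by apply/negP; rewrite -ltNge; exact: sub.
Qed.

End psi.

Lemma solution_pos_near_origin : exists2 mu : R, 0 < mu &
  forall x, 1 <= x 0 N -> sqdist e x <= 1 -> mu <= u x.
Proof.
have [||x [x1 _ _] xmin] := solution_min Nlast (c := e) (t0 := 1) (s1 := -1) (s2 := 1) sol.
- by [].
- by exists e; split; rewrite ?axisN // sqdist_axis subrr expr0n /=; lra.
exists (u x); first by apply: u_gt0; exact: lt_le_trans x1.
move=> y y1 ys; apply: xmin; split=> //.
by apply: le_trans (sqdist_ge0 _ _); lra.
Qed.

(** [Phi] is at most 1 on the unit half-sphere, so the minimum [mu] near [e] serves as constant;
    strictness of the differential inequality comes from [u^p > 0]. *)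
Lemma Phi_lower : exists2 c0 : R, 0 < c0 &
  forall x, 1 < x 0 N -> 1 <= sqdist e x -> c0 * Phi (x 0 N - 1) (sqdist e x) <= u x.
Proof.
have [mu mu_gt0 muP] := solution_pos_near_origin.
exists mu => // x x1 s1.
have psiE y : psi mu 0 0 0 y = mu * Phi (y 0 N - 1) (sqdist e y).
  by rewrite /psi /Phi; ring.
rewrite -psiE; apply: quarter_comparison => //; first exact: ltW.
- move=> y y1 ys; rewrite psiE /Phi ys powR1 mulr1.
  apply: le_trans (muP y (ltW y1) _); last by rewrite ys.
  rewrite ger_pMr //; apply: powR_le1; rewrite ?subr_gt0 //.
    by have := sqr_last_le_sqdist N e y; rewrite axisN ys.
  by move: a_ge1; rewrite /a; lra.
- move=> y a00 a0y ayy tr y1 sy t s ell.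
  have t0 : 0 < t by rewrite subr_gt0.
  have ts : t ^+ 2 <= s by have := sqr_last_le_sqdist N e y; rewrite axisN.
  have B := brk_sub_ge0 (erefl a) (ltnW n_gt1) lambda_gt0 leL t0 ts ell.
  have up : 0 < u y `^ p by apply: powR_gt0; apply: u_gt0; lra.
  rewrite !mul0r mulr0 !addr0 -/a -/b; apply: ltr_wpDl => //.
  by rewrite mulr_ge0 ?powR_ge0 // mulr_ge0 // mulr_ge0 ?powR_ge0 // ltW.
Qed.

(** Separates the angle, measured by [r / t], from the radius, whose power shows the degree
    [- nu]. *)
Lemma Phi_polar t r : 0 < t -> 0 < r -> Phi t (r ^+ 2) = (r / t) `^ (- a) * r `^ (- nu).
Proof.
move=> t0 r0; rewrite /Phi -/a -/b powR_div ?(ltW r0) // opprK mulrAC.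
rewrite -powRD ?(gt_eqF r0) ?implybT // mulrC; congr (_ * _).
rewrite -powR_mulrn ?(ltW r0) // -powRrM; congr (_ `^ _).
by rewrite /b /nu; field.
Qed.

Lemma log_lower : 1 < p -> nu * (p - 1) <= 2 ->
  exists2 eps : R, 0 < eps & forall de, 0 < de <= 1 ->
  forall x, 1 < x 0 N -> 1 <= sqdist e x ->
    eps / de * (Phi (x 0 N - 1) (sqdist e x) * (1 - sqdist e x `^ (- de))) <= u x.
Proof.
move=> p_gt1 nup.
have [mu mu_gt0 muP] := solution_pos_near_origin.
have [c0 c0_gt0 c0P] := Phi_lower.
have L_gt0 : 0 < Lambda by exact: lt_le_trans leL.
have a_gt0 : 0 < a by move: a_ge1; lra.
pose C1 := Lambda * (4 * a + 8 * b + 8).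
have C1_gt0 : 0 < C1 by rewrite mulr_gt0 //; move: b_gt0; lra.
pose b' := b + 2^-1.
have b'_gt0 : 0 < b' by rewrite /b'; move: b_gt0; lra.
pose C2 := Lambda * (4 * (a + 1) * b' + 2 * b' * n%:R).
have C2_gt0 : 0 < C2.
  rewrite mulr_gt0 // addr_gt0 // mulr_gt0 //; last by move: n_ge2; lra.
    by rewrite mulr_gt0 //; lra.
  by rewrite mulr_gt0.
pose c3 := lambda * ((a + 1) * (a + 1 - 1)).
have c3_gt0 : 0 < c3 by rewrite mulr_gt0 // mulr_gt0 //; lra.
(* As [C * c3 = 2 * C1], the corrector gains twice what the difference quotient loses, and [C1 * X]
   survives with a plus sign. *)
pose C := 2 * C1 / c3.
have C_gt0 : 0 < C by rewrite divr_gt0 // mulr_gt0.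
pose X0 := C * C2 / C1.
have X0_gt0 : 0 < X0 by rewrite divr_gt0 // mulr_gt0.
pose Z := c0 `^ p * X0 `^ (- (a * (p - 1))).
have Z_gt0 : 0 < Z by rewrite mulr_gt0 // powR_gt0.
(* The first bound gives [psi <= mu] on the unit half-sphere, where the two [k1], [k2] terms cancel;
   the second lets [u^p] absorb [C * C2]. Neither involves [de]. *)
pose eps := Num.min (mu / C) (Z / (2 * (C * C2))).
have CC2_gt0 : 0 < C * C2 by rewrite mulr_gt0.
have eps_gt0 : 0 < eps.
  by rewrite lt_min !divr_gt0 // mulr_gt0.
have epsC : eps * C <= mu by rewrite -ler_pdivlMr // ge_min lexx.
have epsZ : eps * (C * C2) < Z.
  have : eps <= Z / (2 * (C * C2)) by rewrite ge_min lexx orbT.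
  rewrite ler_pdivlMr; last by rewrite mulr_gt0.
  by lra.
clearbody eps; exists eps => // de /andP[de_gt0 de_le1].
have k_gt0 : 0 < eps / de by rewrite divr_gt0.
have split_s s : 0 < s -> s `^ (- (b + de)) = s `^ (- b) * s `^ (- de).
  by move=> s0; rewrite opprD powRD // (gt_eqF s0) implybT.
have psi_ge x : 1 < x 0 N -> 1 <= sqdist e x ->
    psi (eps / de) (- (eps / de)) (eps * C) de x <= u x.
  apply: quarter_comparison.
  - exact: ltW.
  - by rewrite oppr_le0 ltW.
  - by rewrite ltW // mulr_gt0.
  - move=> y y1 ys; rewrite /psi ys !powR1 !mulr1 subrr mulr0 add0r.
    apply: le_trans (muP y (ltW y1) _); last by rewrite ys.
    apply: le_trans epsC; rewrite ler_piMl ?(ltW (mulr_gt0 eps_gt0 C_gt0)) //.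
    apply: powR_le1; rewrite ?subr_gt0 //.
      by have := sqr_last_le_sqdist N e y; rewrite axisN ys.
    by move: a_gt0; rewrite /a; lra.
  move=> y a00 a0y ayy tr y1 sy t s ell; rewrite -/a -/b.
  have t0 : 0 < t by rewrite subr_gt0.
  have ts : t ^+ 2 <= s by have := sqr_last_le_sqdist N e y; rewrite axisN.
  have s0 : 0 < s by rewrite /s; lra.
  pose r := Num.sqrt s.
  have r0 : 0 < r by rewrite sqrtr_gt0.
  have rE : s = r ^+ 2 by rewrite sqr_sqrtr // ltW.
  have r_ge1 : 1 <= r.
    by rewrite -[1]sqrtr1; apply: ler_wsqrtr; rewrite /s ltW.
  have t_le : t <= r by move: ts; rewrite rE ler_sqr // nnegrE ltW.
  have B0 := brk_sub_ge0 (erefl a) (ltnW n_gt1) lambda_gt0 leL t0 ts ell.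
  rewrite -/b in B0.
  rewrite (split_s s s0).
  have -> : s `^ (- (b + 2^-1)) = s `^ (- b) / r.
    rewrite opprD powRD ?(gt_eqF s0) ?implybT // [s `^ (- 2^-1)]powRN.
    by rewrite powR12_sqrt // ltW.
  have -> : t `^ (a + 1) = t `^ a * t.
    by rewrite powRD ?(gt_eqF t0) ?implybT // powRr1 // ltW.
  set w := s `^ (- de).
  have w_gt0 : 0 < w by exact: powR_gt0.
  have w_le1 : w <= 1.
    have s1 : 1 <= s by rewrite /s ltW.
    by rewrite -(powRr0 s); apply: (ler_powR s1); rewrite oppr_le0 ltW.
  have cy := c0P y y1 (ltW sy); rewrite -/t -/s in cy.
  have G_gt0 : 0 < Phi t s by rewrite mulr_gt0 // powR_gt0.
  have GE : Phi t s = t `^ a * s `^ (- b) by [].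
  have t_r : 0 < t <= r by rewrite t0.
  have de01 : 0 < de <= 1 by rewrite de_gt0.
  rewrite rE in ell.
  have D := brk_diff_lower lambda_gt0 leL (ltW a_gt0) (ltW b_gt0) de01 t_r ell.
  have a1_ge1 : 1 <= a + 1 by lra.
  have B' := brk_corrector_lower lambda_gt0 leL a1_ge1 (ltW b'_gt0) t_r ell.
  rewrite -rE -/C1 -/C2 -/c3 -/b' in D B'.
  set Bab := brk a b _ _ _ _ _ _ in B0 D *.
  set Bde := brk a (b + de) _ _ _ _ _ _ in D *.
  set Bc := brk (a + 1) _ _ _ _ _ _ _ in B' *.
  set X := r / t in D B'.
  have X_gt0 : 0 < X by rewrite divr_gt0.
  set G := Phi t s in cy G_gt0 GE.
  (* A discrete product rule: the factor [1 / de] multiplies only a nonnegative term and a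
     difference quotient that is bounded below uniformly in [de]. *)
  have -> : t `^ a * (eps / de * s `^ (- b) * Bab +
      - (eps / de) * (s `^ (- b) * w) * Bde) +
      t `^ a * t * (eps * C * (s `^ (- b) / r) * Bc) =
    eps * G * ((1 - w) * Bab / de + w * ((Bab - Bde) / de) + C * (t / r * Bc)).
    by rewrite GE; field; rewrite !gt_eqF.
  have Q_gt0 : 0 < s^-1 by rewrite invr_gt0.
  have lower : (C1 * X - C * C2) * s^-1 <=
      (1 - w) * Bab / de + w * ((Bab - Bde) / de) + C * (t / r * Bc).
    have e1 : 0 <= (1 - w) * Bab / de.
      by rewrite mulr_ge0 ?invr_ge0 ?(ltW de_gt0) // mulr_ge0 // subr_ge0.
    have e2 : - (C1 * X * s^-1) <= w * ((Bab - Bde) / de).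
      apply: (@le_trans _ _ (w * - (C1 * X * s^-1))); last by rewrite ler_pM2l.
      rewrite mulrN lerN2 ler_piMl //.
      by rewrite mulr_ge0 ?(ltW Q_gt0) // mulr_ge0 // ltW.
    have e3 : C * ((c3 * X - C2) * s^-1) <= C * (t / r * Bc) by rewrite ler_pM2l.
    have Cc3 : C * c3 = 2 * C1 by rewrite /C divfK // gt_eqF.
    have e4 : C * ((c3 * X - C2) * s^-1) = (C * c3) * X * s^-1 - C * C2 * s^-1 by ring.
    move: e3; rewrite e4 Cc3; lra.
  have U_gt0 : 0 < u y by apply: u_gt0; lra.
  have up_gt0 : 0 < u y `^ p by exact: powR_gt0.
  have eG_gt0 : 0 < eps * G by rewrite mulr_gt0.
  have lower' := ler_wpM2l (ltW eG_gt0) lower.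
  (* Near the boundary, where [X] is large, the corrector absorbs the error term;
     elsewhere [u^p] does. *)
  have [XX0|XX0] := leP X0 X.
    apply: ltr_wpDl up_gt0; apply: le_trans lower'.
    apply: mulr_ge0 (ltW eG_gt0) _; rewrite mulr_ge0 ?(ltW Q_gt0) // subr_ge0.
    by move: XX0; rewrite /X0 ler_pdivrMr // [X * _]mulrC.
  have p1_gt0 : 0 < p - 1 by rewrite subr_gt0.
  (* [Phi^(p - 1)] splits into an angular factor, bounded below since [X < X0], and
     [r^(- nu * (p - 1))], which is at least [r^(-2)] by criticality and [r >= 1]. *)
  have up_ge : Z * G * s^-1 <= u y `^ p.
    have cG_gt0 : 0 < c0 * G by rewrite mulr_gt0.
    apply: (@le_trans _ _ ((c0 * G) `^ p)); last first.
      apply: ge0_ler_powR cy; rewrite ?nnegrE ?(ltW cG_gt0) ?(ltW U_gt0) //.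
      by rewrite ltW // (lt_trans ltr01).
    rewrite powRM ?(ltW c0_gt0) ?(ltW G_gt0) //.
    rewrite -(mulr_powRB1 (ltW G_gt0) (lt_trans ltr01 p_gt1)).
    rewrite /Z; set z := X0 `^ _.
    have -> : c0 `^ p * z * G * s^-1 = c0 `^ p * (G * (z * s^-1)) by ring.
    rewrite (ler_pM2l (powR_gt0 p c0_gt0)) (ler_pM2l G_gt0) /z.
    rewrite /G rE (Phi_polar t0 r0) -/X powRM ?powR_ge0 //.
    apply: ler_pM; rewrite ?powR_ge0 ?invr_ge0 ?sqr_ge0 //.
      rewrite -powRrM mulNr !powRN lef_pV2 ?posrE ?powR_gt0 //.
      apply: ge0_ler_powR; rewrite ?nnegrE ?(ltW X_gt0) ?(ltW X0_gt0) ?(ltW XX0) //.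
      by rewrite mulr_ge0 // ltW.
    rewrite -powRrM -(powR_mulrn 2 (ltW r0)) -powRN; apply: (ler_powR r_ge1).
    by rewrite mulNr lerN2.
  apply: lt_le_trans (lerD lower' up_ge).
  have h1 : 0 <= eps * G * (C1 * X * s^-1).
    apply: mulr_ge0 (ltW eG_gt0) _; apply: mulr_ge0 (ltW Q_gt0).
    by rewrite mulr_ge0 // ltW.
  have : 0 < (Z - eps * (C * C2)) * (G * s^-1).
    by apply: mulr_gt0; [rewrite subr_gt0|exact: mulr_gt0].
  have -> : eps * G * ((C1 * X - C * C2) * s^-1) + Z * G * s^-1 =
    eps * G * (C1 * X * s^-1) + (Z - eps * (C * C2)) * (G * s^-1) by ring.
  by move=> h2; exact: ltr_wpDl h1 h2.
move=> x x1 s1; apply: le_trans (psi_ge x x1 s1).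
have s0 : 0 < sqdist e x by lra.
rewrite /psi -/a -/b (split_s _ s0) /Phi -/a -/b.
set G := _ `^ a; set H := _ `^ (- b); set w := _ `^ (- de).
have -> : eps / de * (G * H * (1 - w)) = G * (eps / de * H + - (eps / de) * (H * w)).
  by ring.
rewrite lerDl; apply: mulr_ge0; first exact: powR_ge0.
by rewrite mulr_ge0 ?powR_ge0 // ltW // mulr_gt0.
Qed.

(** The small ball lies in the cone [r <= 2 * t] with vertex [e], at distance comparable to [rho],
    so both polar factors of [Phi] are controlled. *)
Lemma Phi_ball_lower (rho : R) x : 0 < rho ->
  sqdist (axis (1 + rho)) x <= rho ^+ 2 / 16 ->
  [/\ 1 < x 0 N, rho ^+ 2 / 2 <= sqdist e x &
      2 `^ (- a) * (2 * rho) `^ (- nu) <= Phi (x 0 N - 1) (sqdist e x)].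
Proof.
move=> rho_gt0 xr; have a_gt0 : 0 < a by exact: lt_le_trans a_ge1.
have := sqr_last_le_sqdist N (axis (1 + rho)) x; rewrite axisN => tr.
have := sqdist_axis_shift N 1 (1 + rho) x.
have := sqr_last_le_sqdist N e x; rewrite axisN.
set s := sqdist e x; set t := x 0 N - 1.
have tE : x 0 N - (1 + rho) = t - rho by rewrite /t; ring.
rewrite tE in tr *; move=> ts shift.
have t_ge : 3 / 4 * rho <= t by nra.
have t_le : t <= 5 / 4 * rho by nra.
have t0 : 0 < t by lra.
have s_le : s <= 2 * rho ^+ 2 by nra.
have s0 : 0 < s by nra.
split; [by rewrite -subr_gt0|nra|].
pose r := Num.sqrt s.
have r0 : 0 < r by rewrite sqrtr_gt0.
have rE : s = r ^+ 2 by rewrite sqr_sqrtr // ltW.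
have r2t : r <= 2 * t by rewrite rE in s_le; nra.
have r2rho : r <= 2 * rho by rewrite rE in s_le; nra.
rewrite rE (Phi_polar t0 r0) -/a -/nu.
have rt0 : 0 < r / t by rewrite divr_gt0.
have rho2 : 0 < 2 * rho by lra.
apply: ler_pM; rewrite ?powR_ge0 // !powRN lef_pV2 ?posrE ?powR_gt0 //.
  apply: ge0_ler_powR; rewrite ?nnegrE ?(ltW a_gt0) ?(ltW rt0) //.
  by rewrite ler_pdivrMr.
by apply: ge0_ler_powR; rewrite ?nnegrE ?(ltW nu_gt0) ?(ltW r0) ?(ltW rho2).
Qed.

Lemma no_solution_p_gt1 : 1 < p -> nu * (p - 1) <= 2 -> False.
Proof.
move=> p_gt1 nup.
have [eps eps_gt0 epsP] := log_lower p_gt1 nup.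
have L_gt0 : 0 < Lambda by exact: lt_le_trans leL.
have p_gt0 : 0 < p by lra.
have p1_gt0 : 0 < p - 1 by lra.
pose q := barrier_ratio.
have q_gt0 : 0 < q := barrier_ratio_gt0.
have q_le : q <= 4^-1 := barrier_ratio_le.
pose K := (q * (1 - q)) `^ p.
have qq_gt0 : 0 < q * (1 - q) by rewrite mulr_gt0 //; lra.
have K_gt0 : 0 < K by exact: powR_gt0.
pose C := 16 * Lambda * n%:R.
have C_ge0 : 0 <= C by rewrite mulr_ge0 // mulr_ge0 // ltW.
(* Chosen so that [m >= Y * rho^(- nu)] already contradicts [m^(p - 1) * K <= C / rho ^+ 2]; here
   [nu * (p - 1) <= 2] is used again. *)
pose Y := ((C + 1) / K) `^ (p - 1)^-1.
have CK_gt0 : 0 < (C + 1) / K by rewrite divr_gt0 //; lra.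
have Y_gt0 : 0 < Y by exact: powR_gt0.
pose c1 := eps * (2 `^ (- a) * 2 `^ (- nu)) / 2.
have c1_gt0 : 0 < c1.
  by rewrite divr_gt0 // mulr_gt0 // mulr_gt0 // powR_gt0.
pose de := c1 / (c1 + Y).
have cY_gt0 : 0 < c1 + Y by rewrite addr_gt0.
have de_gt0 : 0 < de by rewrite divr_gt0.
have de_le1 : de <= 1 by rewrite ler_pdivrMr // mul1r lerDl ltW.
have de01 : 0 < de <= 1 by rewrite de_gt0.
have c1de : c1 / de = c1 + Y by rewrite /de; field; rewrite !gt_eqF.
(* [h^(- de) = 1 / 2], and [s >= rho ^+ 2 / 2 >= h] on the small ball, so [1 - s^(- de)] is at least
   the 1/2 built into [c1]. *)
pose h := 2 `^ de^-1 : R.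
have h_ge1 : 1 <= h.
  rewrite -(powRr0 2); apply: ler_powR; first lra.
  by rewrite invr_ge0 ltW.
pose rho := 2 * h.
have rho_ge2 : 2 <= rho by rewrite /rho; lra.
have rho_gt0 : 0 < rho by lra.
have [x [xr m_gt0 /(_ (ltW p_gt0)) h1 _]] :=
  ball_estimate rho_gt0.
rewrite -/q -/C in h1.
have [x1 s_ge Phi_ge] := Phi_ball_lower rho_gt0 xr.
have hs : h <= sqdist e x by apply: le_trans s_ge; rewrite /rho; nra.
have s1 : 1 <= sqdist e x by exact: le_trans hs.
clearbody rho.
have := epsP de de01 x x1 s1.
set m := u x in m_gt0 h1 *; set F := Phi _ _ in Phi_ge *; set w := _ `^ (- de).
have w_le : w <= 2^-1.
  have -> : 2^-1 = h `^ (- de) by rewrite /h -powRrM mulrN mulVf ?gt_eqF // powR_inv1.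
  rewrite /w !powRN lef_pV2 ?posrE ?powR_gt0 //; [|lra..].
  by apply: ge0_ler_powR; rewrite ?nnegrE ?(ltW de_gt0) //; lra.
move=> m_ge.
have m_ge' : (c1 + Y) * rho `^ (- nu) <= m.
  apply: le_trans m_ge.
  have -> : (c1 + Y) * rho `^ (- nu) =
      eps / de * (2 `^ (- a) * (2 * rho) `^ (- nu) * 2^-1).
    by rewrite -c1de /c1 powRM ?(ltW rho_gt0) //; field; rewrite gt_eqF.
  clearbody c1.
  rewrite ler_pM2l ?divr_gt0 //.
  apply: ler_pM => //; last by lra.
  by rewrite mulr_ge0 ?powR_ge0.
have m_pow : (c1 + Y) `^ (p - 1) * (rho ^+ 2)^-1 <= m `^ (p - 1).
  apply: (@le_trans _ _ (((c1 + Y) * rho `^ (- nu)) `^ (p - 1))); last first.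
    apply: ge0_ler_powR; rewrite ?nnegrE ?(ltW p1_gt0) ?(ltW m_gt0) //.
    by rewrite mulr_ge0 ?powR_ge0 ?(ltW cY_gt0).
  rewrite powRM ?powR_ge0 ?(ltW cY_gt0) //. rewrite ler_pM2l ?powR_gt0 //.
  rewrite -powRrM -(powR_mulrn 2 (ltW rho_gt0)) -powRN; apply: ler_powR; first lra.
  by rewrite mulNr lerN2.
have Y_pow : (C + 1) / K <= (c1 + Y) `^ (p - 1).
  have -> : (C + 1) / K = Y `^ (p - 1).
    by rewrite /Y -powRrM mulVf ?gt_eqF // powRr1 // ltW.
  apply: ge0_ler_powR; rewrite ?nnegrE ?(ltW p1_gt0) ?(ltW Y_gt0) ?(ltW cY_gt0) //.
  by rewrite lerDr ltW.
have mC : m `^ (p - 1) * K <= C / rho ^+ 2.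
  rewrite -(ler_pM2l m_gt0) mulrA (mulr_powRB1 (ltW m_gt0) p_gt0).
  by move: h1; rewrite powRM ?(ltW m_gt0) ?(ltW qq_gt0) // -/K; lra.
have r2_gt0 : 0 < rho ^+ 2 by rewrite exprn_gt0.
have : (C + 1) / K * (rho ^+ 2)^-1 * K <= C / rho ^+ 2.
  apply: le_trans mC; rewrite ler_pM2r //; apply: le_trans m_pow.
  by rewrite ler_pM2r // invr_gt0.
have -> : (C + 1) / K * (rho ^+ 2)^-1 * K = (C + 1) / rho ^+ 2.
  by field; rewrite !gt_eqF.
by rewrite ler_pM2r ?invr_gt0 //; lra.
Qed.

End halfspace_solution.

Theorem theorem1p1 (R : realType) (n : nat) (lambda Lambda p : R)
    (n_ge2 : (2 <= n)%N) (lambda_gt0 : 0 < lambda)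
    (le_lambda_Lambda : lambda <= Lambda)
    (p_ge : -1 <= p)
    (p_le : p <= (Lambda / lambda * n%:R + 1) / (Lambda / lambda * n%:R - 1)) :
  ~ exists u : 'rV[R]_n -> R, positive_viscosity_solution lambda Lambda p u.
Proof.
move=> [u sol].
have n_gt0 : (n.-1 < n)%N by rewrite ltn_predL ltnW.
pose N := Ordinal n_gt0; have Nlast : N.+1 = n by rewrite /= (ltn_predK n_gt0).
have [p0|p_gt0] := leP p 0.
  by apply: (no_solution_pN10 Nlast lambda_gt0 le_lambda_Lambda sol); rewrite p_ge.
have [p1|p_gt1] := leP p 1.
  by apply: (no_solution_p01 Nlast lambda_gt0 le_lambda_Lambda sol); rewrite p_gt0.
apply: (no_solution_p_gt1 Nlast lambda_gt0 le_lambda_Lambda sol n_ge2 p_gt1).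
have a_ge1 : 1 <= Lambda / lambda by rewrite ler_pdivlMr // mul1r.
have n2 : 2 <= n%:R :> R by rewrite ler_nat.
move: p_le; set a := Lambda / lambda in a_ge1 *.
(* Clearing the denominator, positive since [a >= 1] and [n >= 2], turns the bound on [p] into
   [nu * (p - 1) <= 2]. *)
rewrite ler_pdivlMr; last by nra.
lra.
Qed.
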